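(* There is a digraph $H$ (possibly with loops) for which the problem \textsc{$H$-Word Reachability} is \textsf{PSPACE}-complete.
   Context: For a digraph $H=(\Sigma,E)$ with $E\subseteq\Sigma^2$ (loops allowed), a word $a_1a_2\dots a_n$ over $\Sigma$ is an $H$-word if $(a_i,a_{i+1})\in E$ for all $1\le i<n$ (i.e., it is a walk in $H$). \textsc{$H$-Word Reachability} ($H$ fixed): given two $H$-words $s,t$ of equal length, decide whether $s$ can be transformed into $t$ by a sequence of steps, each changing the symbol at a single position, such that every intermediate word is an $H$-word. *)

(* Defs.v *)
From Stdlib Require Import Relations.
From mathcomp Require Import all_boot.
Set Implicit Arguments. Unset Strict Implicit. Unset Printing Implicit Defensive.

Definition Hword (S : finType) (E : rel S) (w : seq S) : bool := sorted E w.

Definition Hstep (S : finType) (E : rel S) (u v : seq S) : Prop :=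
  [/\ Hword E u, Hword E v, size u = size v &
      count (fun p : S * S => p.1 != p.2) (zip u v) <= 1].

Definition Hreach (S : finType) (E : rel S) : relation (seq S) :=
  clos_refl_trans (seq S) (@Hstep S E).

Definition HWR_lang (S : finType) (E : rel S) (x : seq (option S)) : Prop :=
  exists s t : seq S,
    [/\ x = map Some s ++ None :: map Some t,
        Hword E s, Hword E t, size s = size t & Hreach E s t].

Record TM (A : Type) : Type := {
  tm_state : finType;
  tm_sym : finType;
  tm_blank : tm_sym;
  tm_input : A -> tm_sym;
  tm_start : tm_state;
  tm_halting : tm_state -> bool;
  tm_accepting : tm_state -> bool;
  (* new state, written symbol, move (true = right, false = left) *)
  tm_delta : tm_state -> tm_sym -> tm_state * tm_sym * bool
}.

Arguments tm_blank {A} t.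
Arguments tm_input {A} t _.
Arguments tm_start {A} t.
Arguments tm_halting {A} t _.
Arguments tm_accepting {A} t _.
Arguments tm_delta {A} t _ _.

Section TMsem.
Variables (A : Type) (M : TM A).

(* configuration: state, cells left of head (nearest first), head cell,
   cells right of head; cells beyond the right list are blank *)
Definition config : Type :=
  (tm_state M * seq (tm_sym M) * tm_sym M * seq (tm_sym M))%type.

Definition cstate (c : config) : tm_state M := c.1.1.1.

Definition tm_step (c : config) : config :=
  let: (q, l, a, r) := c in
  if tm_halting M q then c else
  let: (q', b, mv) := tm_delta M q a in
  if mv then
    match r with
    | [::] => (q', b :: l, tm_blank M, [::])
    | x :: r' => (q', b :: l, x, r')
    end
  else
    match l with
    | [::] => (q', [::], b, r)
    | x :: l' => (q', l', x, b :: r)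
    end.

Definition tm_init (w : seq A) : config :=
  match map (tm_input M) w with
  | [::] => (tm_start M, [::], tm_blank M, [::])
  | a :: r => (tm_start M, [::], a, r)
  end.

Definition tm_run (n : nat) (w : seq A) : config := iter n tm_step (tm_init w).

(* number of tape cells touched so far (including the input) *)
Definition tm_space (c : config) : nat :=
  let: (_, l, _, r) := c in size l + 1 + size r.

Definition tm_contents (c : config) : seq (tm_sym M) :=
  let: (_, l, a, r) := c in catrev l (a :: r).

End TMsem.

Definition polyb (k n : nat) : nat := k * n ^ k + k.

Definition in_PSPACE (A : finType) (L : seq A -> Prop) : Prop :=
  exists (M : TM A) (k : nat), forall w : seq A,
    (exists n, tm_halting M (cstate (tm_run M n w)) /\
               (tm_accepting M (cstate (tm_run M n w)) <-> L w)) /\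
    (forall n, tm_space (tm_run M n w) <= polyb k (size w)).

Definition poly_time_computable (B A : finType) (f : seq B -> seq A) : Prop :=
  exists (M : TM B) (out : tm_sym M -> option A) (k : nat), forall w : seq B,
    tm_halting M (cstate (tm_run M (polyb k (size w)) w)) /\
    pmap out (tm_contents (tm_run M (polyb k (size w)) w)) = f w.

Definition PSPACE_hard (A : finType) (L : seq A -> Prop) : Prop :=
  forall (B : finType) (L' : seq B -> Prop), in_PSPACE L' ->
    exists f : seq B -> seq A,
      poly_time_computable f /\ forall w, L' w <-> L (f w).

Definition PSPACE_complete (A : finType) (L : seq A -> Prop) : Prop :=
  in_PSPACE L /\ PSPACE_hard L.

(* Main.v *)
(* An undirected reachability question on words of length [n] over [S] is settled
   by Savitch's recursion on midpoints in space [O(n^2)], whatever the digraph.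

   For hardness we need one digraph into which every polynomial-space machine [M]
   can be compiled.  The computation of [M] is carried out by a fixed machine whose
   head shuttles along a row of bits while executing, in each sweep, one round of a
   cyclic program stored next to the bits; a tape cell of [M] becomes a block of
   bits, and every block contains a copy of the program.  The moves of this machine
   are rewriting rules [ab -> cd], and such a system becomes a digraph once words
   are spelled by overlapping pairs of letters: a pair being rewritten is replaced
   by a letter naming the rule, which lets its two neighbours change one at a time.
   The steps of the digraph are reversible, but the machine is deterministic; hence
   a word is connected with a word on which the machine is stuck if and only if the
   machine runs from the former to the latter.

   All Turing machines are obtained from queue machines which repeatedly sweep
   over a word. *)
Require Import Defs.
From HB Require Import structures.
From Stdlib Require Import Relations.
From mathcomp Require Import all_boot zify.
Set Implicit Arguments. Unset Strict Implicit. Unset Printing Implicit Defensive.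

(** * Queue machines *)

(** The digraph must not depend on the machine compiled, so the whole program has to be data. This
    is why the shuttle manipulates single bits: instructions acting on one carry bit and one stored
    bit form a finite set that is the same for all machines. A simulated step then takes many
    sweeps, which does not matter, since only the length of the words counts. That length is fixed.
    So all the space a machine may use is laid out in advance as blank cells, and the target word
    must be known without running the machine: an accepting run erases the row and gets stuck on a
    word that depends on the length alone. Erasing destroys information, so the stuck word has many
    histories, but only the uniqueness of the forward run is used. A rejecting machine is not
    allowed to get stuck at all; its halted configuration is simulated over and over. *)

Section QueueMachine.
Variables (Q G : finType) (d : Q -> G -> Q * seq G) (h : pred Q).

Definition qstep (c : Q * seq G) : Q * seq G :=
  if h c.1 then c else
  if c.2 is a :: w then ((d c.1 a).1, w ++ (d c.1 a).2) else c.

(** [QPush] holds the output still to be written. It may be one longer than the longest output,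
    because the first step writes the end marker as well. *)
Inductive qtm_state :=
  | QInit
  | QFront of Q
  | QPush of Q & {bseq (\max_p size (d p.1 p.2).2).+1 of G}
  | QShift of Q & option G.

Definition qtm_code s := match s with
  | QInit => None
  | QFront q => Some (inl q)
  | QPush q o => Some (inr (inl (q, o)))
  | QShift q c => Some (inr (inr (q, c))) end.
Definition qtm_decode s := match s with
  | None => QInit
  | Some (inl q) => QFront q
  | Some (inr (inl (q, o))) => QPush q o
  | Some (inr (inr (q, c))) => QShift q c end.
Lemma qtm_codeK : cancel qtm_code qtm_decode. Proof. by case. Qed.
HB.instance Definition _ := Equality.copy qtm_state (can_type qtm_codeK).
HB.instance Definition _ := Choice.copy qtm_state (can_type qtm_codeK).
HB.instance Definition _ := Countable.copy qtm_state (can_type qtm_codeK).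
HB.instance Definition _ := Finite.copy qtm_state (can_type qtm_codeK).

Definition qpush q (o : seq G) : qtm_state := QPush q (insub_bseq _ o).

(** A left move on the first cell leaves the head where it is, so the left end can be noticed only
    if it is marked on the tape. *)
Definition qtm_delta (s : qtm_state) (x : option G * bool) :
    qtm_state * (option G * bool) * bool :=
  match s, x with
  | QPush q o, (Some a, f) => (s, x, true)
  | QPush q o, (None, f) =>
      if val o is y :: o' then (qpush q o', (Some y, false), true)
      else (QShift q None, (None, false), false)
  | QShift q c, (g, f) =>
      if f then (QFront q, (c, true), false) else (QShift q g, (c, false), false)
  | QFront q, (Some a, f) => (qpush (d q a).1 (d q a).2, (Some a, true), true)
  | _, _ => (s, x, false)
  end.

(* Bit [true] of a tape symbol flags the leftmost cell, where the front of the
   queue is kept; popping is done by the leftward walk, which shifts the queue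
   by one cell.  A machine started in [QInit] behaves as if the end marker [e]
   had already been appended to its input. *)
Definition qtm (A : Type) (inj : A -> G) (e : G) (q0 : Q) (acc : pred Q) : TM A := {|
  tm_state := qtm_state;
  tm_sym := (option G * bool)%type;
  tm_blank := (None, false);
  tm_input a := (Some (inj a), false);
  tm_start := QInit;
  tm_halting s := if s is QFront q then h q else false;
  tm_accepting s := if s is QFront q then acc q else false;
  tm_delta s x := match s, x with
    | QInit, (Some a, _) => (qpush (d q0 a).1 (e :: (d q0 a).2), (Some a, true), true)
    | QInit, (None, _) => (qpush (d q0 e).1 (d q0 e).2, (None, true), true)
    | _, _ => qtm_delta s x end |}.

Section Run.
Variables (A : Type) (inj : A -> G) (e : G) (q0 : Q) (acc : pred Q).
Let M := qtm inj e q0 acc.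
Let sym (a : G) : tm_sym M := (Some a, false).
Let bl : tm_sym M := (None, false).

Lemma size_out q a : size (d q a).2 < (\max_p size (d p.1 p.2).2).+1.
Proof. by rewrite ltnS; apply: (leq_bigmax (q, a)). Qed.

Lemma tm_space_step c : tm_space (@tm_step A M c) >= tm_space c.
Proof.
case: c => [[[q l] a] r]; rewrite /tm_step; case: ifP => // _.
by case: (tm_delta _ q a) => [[q' b] []]; case: r => [|x r]; case: l => [|y l] //=; lia.
Qed.

Lemma tm_space_run m n c : m <= n ->
  tm_space (iter m (@tm_step A M) c) <= tm_space (iter n (@tm_step A M) c).
Proof.
move/subnK => <-; elim: (n - m) => // k IH; rewrite addSn iterS.
exact: leq_trans IH (tm_space_step _).
Qed.

(** The [j] blanks are cells already visited beyond the queue; they are recorded because [tm_space]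
    counts them. *)
Definition qtape q (u : seq G) j : config M :=
  match u with
  | [::] => (QFront q : tm_state M, [::], (None, true) : tm_sym M, nseq j bl)
  | a :: u => (QFront q : tm_state M, [::], (Some a, true) : tm_sym M, map sym u ++ nseq j bl)
  end.

Lemma push_skip q o u l j :
  iter (size u) (@tm_step A M) (QPush q o : tm_state M, l, head bl (map sym u ++ nseq j bl),
     behead (map sym u ++ nseq j bl)) =
  (QPush q o : tm_state M, catrev (map sym u) l, bl, nseq j.-1 bl).
Proof.
elim: u l => [|a u IH] l; first by case: j.
rewrite [size _]/= iterSr.
rewrite [@tm_step A M _](_ : _ = (QPush q o : tm_state M, sym a :: l,
  head bl (map sym u ++ nseq j bl), behead (map sym u ++ nseq j bl))); first exact: IH.
by case: u j {IH} => [|b u] [|j].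
Qed.

Lemma push_word q o l j : size o <= (\max_p size (d p.1 p.2).2).+1 ->
  iter (size o) (@tm_step A M) (qpush q o : tm_state M, l, bl, nseq j bl) =
  (qpush q [::] : tm_state M, catrev (map sym o) l, bl, nseq (j - size o) bl).
Proof.
elim: o l j => [|a o IH] l j; first by rewrite subn0.
move=> so; rewrite [size _]/= iterSr.
rewrite [@tm_step A M _](_ : _ = (qpush q o : tm_state M, sym a :: l, bl, nseq j.-1 bl)).
  by rewrite IH ?(ltnW so) //; congr (_, _, _, nseq _ _); lia.
by rewrite /tm_step /= insubdK //=; case: j.
Qed.

Lemma shift_left q u c l g r : 
  iter (size u).+2 (@tm_step A M)
    (QShift q c : tm_state M, catrev (map sym u) [:: (g, true)], (l, false) : tm_sym M, r) =
  (QFront q : tm_state M, [::], (head l (rcons (map (@Some G) u) l), true) : tm_sym M,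
     behead (map (fun x => (x, false) : tm_sym M) (rcons (map (@Some G) u) l)) ++
     (c, false) :: r).
Proof.
elim/last_ind: u c l r => [|u a IH] c l r; first by [].
rewrite size_rcons iterSr map_rcons -cats1 catrev_catl.
rewrite [@tm_step A M _](_ : _ = (QShift q l : tm_state M,
  catrev (map sym u) [:: (g, true)], (Some a, false) : tm_sym M, (c, false) :: r)) //.
rewrite (IH l (Some a)) map_rcons.
by case: u {IH} => [|b u] //=; rewrite !map_rcons -!cats1 -!catA.
Qed.

Lemma push_shift q o u g j : size o <= (\max_p size (d p.1 p.2).2).+1 ->
  exists2 j', iter (2 * (size u + size o) + 2) (@tm_step A M)
      (qpush q o : tm_state M, [:: (g, true)], head bl (map sym u ++ nseq j bl),
       behead (map sym u ++ nseq j bl)) = qtape q (u ++ o) j'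
    & tm_space (qtape q (u ++ o) j') <= maxn (size u + j).+1 (size u + size o).+2.
Proof.
(* The head passes [u], writes [o], turns, and comes back over the whole word and the flagged
   cell. *)
move=> so; have -> : 2 * (size u + size o) + 2 =
  (size (u ++ o)).+1 + (1 + (size o + size u)) by rewrite size_cat; lia.
rewrite !iterD push_skip push_word // -catrev_catl -map_cat -size_cat.
have : size (u ++ o) = size u + size o by rewrite size_cat.
case/lastP: (u ++ o) => [|v y] sv.
  exists (j.-1 - size o).+1; first by rewrite /= insubdK.
  by rewrite /= size_nseq; lia.
exists (j.-1 - size o).+2.
  have -> : catrev (map sym (rcons v y)) [:: (g, true)] =
    sym y :: catrev (map sym v) [:: (g, true)] by rewrite map_rcons -cats1 catrev_catl.
  rewrite [iter 1 _ _](_ : _ = (QShift q None : tm_state M,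
    catrev (map sym v) [:: (g, true)], sym y, bl :: nseq (j.-1 - size o) bl)).
    2: by rewrite /= insubdK.
  rewrite size_rcons (shift_left q v None (Some y)).
  by case: v {sv} => [|b v] //=; rewrite -map_rcons -map_comp.
move: sv; rewrite size_rcons => sv.
have -> : forall j', tm_space (qtape q (rcons v y) j') = size v + 1 + j'.
  by case: v {sv} => [|b v] j' /=; rewrite ?size_cat ?size_map ?size_rcons ?size_nseq; lia.
lia.
Qed.

Lemma qtm_step q u j : ~~ h q ->
  exists n j', [/\ n <= 2 * (size u + size (qstep (q, u)).2) + 3,
    iter n (@tm_step A M) (qtape q u j) = qtape (qstep (q, u)).1 (qstep (q, u)).2 j' &
    tm_space (qtape (qstep (q, u)).1 (qstep (q, u)).2 j') <=
      maxn (tm_space (qtape q u j)) (size (qstep (q, u)).2).+2].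
Proof.
rewrite /qstep /= => /negbTE hq; rewrite hq.
case: u => [|a u]; first by exists 0, j; split => //; rewrite leq_max leqnn.
have [j' E sp] := push_shift (d q a).1 u (Some a) j (ltnW (size_out q a)).
exists (2 * (size u + size (d q a).2) + 3), j'; split.
- by rewrite /= size_cat; lia.
- by rewrite addnS iterSr /= -E {1}/tm_step /= hq; congr iter; case: (map sym u ++ _).
- by rewrite /= size_cat size_map size_nseq size_cat in sp *; lia.
Qed.

Lemma qtm_start w : ~~ h q0 ->
  let c := qstep (q0, map inj w ++ [:: e]) in
  exists n j', [/\ n <= 2 * (size w).+1 + 2 * size c.2 + 3,
    tm_run M n w = qtape c.1 c.2 j' & tm_space (qtape c.1 c.2 j') <= (size c.2).+2].
Proof.
rewrite /qstep /= => /negbTE hq; rewrite hq /tm_run /tm_init.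
case: w => [|a w] /=.
  have [j E sp] := @push_shift (d q0 e).1 (d q0 e).2 [::] None 0 (ltnW (size_out q0 e)).
  exists (2 * (0 + size (d q0 e).2) + 3), j; split => //; first by lia.
  by rewrite addnS iterSr -E.
rewrite -catA /=.
have [j E sp] := @push_shift (d q0 (inj a)).1 (e :: (d q0 (inj a)).2) (map inj w) (Some (inj a)) 0
   (size_out q0 (inj a)).
move: E sp; rewrite /= cats0 !size_cat !size_map /= => E sp.
exists (2 * (size w + (size (d q0 (inj a)).2).+1) + 3), j; split => //; first by lia.
  by rewrite addnS iterSr -E /= -map_comp; case: w {E sp}.
by apply: leq_trans sp _; lia.
Qed.

(** Positivity of [K] is required because the tape has the form [qtape] only after the first step
    has set the flag. A step is a round trip over queues of length at most [B], whence
    [4 * B + 3]. *)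
Lemma qtm_run w K : ~~ h q0 -> let c := iter K qstep (q0, map inj w ++ [:: e]) in
  let B := \max_(i < K.+1) size (iter i qstep (q0, map inj w ++ [:: e])).2 in
  0 < K -> exists n j', [/\ n <= K * (4 * B + 3), tm_run M n w = qtape c.1 c.2 j' &
     tm_space (qtape c.1 c.2 j') <= B.+2].
Proof.
move=> hq; elim: K => // -[|K] IH /= _.
  have [n [j [n_le E sp]]] := qtm_start w hq.
  exists n, j; split => //.
    by rewrite !big_ord_recl big_ord0 /= !size_cat !size_map /= addn1; lia.
  by rewrite !big_ord_recl big_ord0 /= ; lia.
have [//|n [j [n_le E sp]]] := IH.
rewrite big_ord_recr /= -/(iter K.+1 qstep _).
set c := iter K.+1 _ _ in E sp *.
set B := \max_(i < K.+2) _ in n_le sp *.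
have sB : size c.2 <= B by rewrite /B big_ord_recr leq_max leqnn orbT.
case hc: (h c.1).
  exists n, j; rewrite /qstep hc; split => //; last by lia.
  by apply: leq_trans n_le _; rewrite leq_mul // ; lia.
have [|n' [j' [n'_le E' sp']]] := @qtm_step c.1 c.2 j; first by rewrite hc.
rewrite -surjective_pairing in n'_le E' sp'.
exists (n' + n), j'; split.
- have := leq_mul (leqnn K.+1) (leq_maxl B (size (qstep c).2)); nia.
- by rewrite -E' -E /tm_run iterD.
- by apply: leq_trans sp' _; lia.
Qed.

End Run.
End QueueMachine.

(** * Sweep machines *)

(** For positive [n] the factor [2 ^ e] comes from [n.+1 <= 2 * n], and the summand [e] makes the
    exponent large enough; at [n = 0] the additive constant of [polyb] suffices. *)
Lemma leq_poly_polyb C e n : C * n.+1 ^ e <= polyb (C * 2 ^ e + e) n.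
Proof.
rewrite /polyb; case: n => [|n].
  rewrite exp1n; have := expn_gt0 2 e; nia.
have le2 : n.+2 ^ e <= 2 ^ e * n.+1 ^ e by rewrite -expnMn; case: e => // e; rewrite leq_exp2r //; lia.
have le3 : n.+1 ^ e <= n.+1 ^ (C * 2 ^ e + e) by rewrite leq_pexp2l // leq_addl.
have := leq_mul (leqnn C) le2; have := leq_mul (leqnn (C * 2 ^ e)) le3; lia.
Qed.

Lemma polyb_leq_poly k n : polyb k n <= 2 * k * n.+1 ^ k.
Proof.
have : n ^ k <= n.+1 ^ k by case: k => // k; rewrite leq_exp2r.
have : 0 < n.+1 ^ k by rewrite expn_gt0.
rewrite /polyb; nia.
Qed.

Lemma tm_halted_run A (M : TM A) n (c : config M) :
  tm_halting M (cstate c) -> iter n (@tm_step A M) c = c.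
Proof.
by move=> hc; elim: n => //= n ->; move: hc; case: c => [[[s l] a] r]; rewrite /tm_step /cstate /= => ->.
Qed.

Section SweepMachine.
Variables (Q G : finType) (d : Q -> G -> Q * seq G) (fin : Q -> Q * seq G) (h : pred Q).
(** Halting is confined to the ends of sweeps, so that a halted queue consists of a whole word and
    its end marker. *)
Hypothesis hd : forall q a, ~~ h q -> ~~ h (d q a).1.

Fixpoint mealy (q : Q) (w : seq G) : Q * seq G :=
  if w is a :: w' then
    ((mealy (d q a).1 w').1, (d q a).2 ++ (mealy (d q a).1 w').2)
  else (q, [::]).

Lemma mealy_cat q v w : mealy q (v ++ w) =
  ((mealy (mealy q v).1 w).1, (mealy q v).2 ++ (mealy (mealy q v).1 w).2).
Proof. by elim: v q => [|a v IH] q /=; [case: mealy|rewrite IH catA]. Qed.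

Definition sweep (c : Q * seq G) : Q * seq G :=
  if h c.1 then c else
  let: (q, w) := mealy c.1 c.2 in ((fin q).1, w ++ (fin q).2).

(** The marker [None] travels around the queue with the word; popping it ends a sweep, and it is put
    back behind the letters added by [fin]. *)
Definition swd (q : Q) (x : option G) : Q * seq (option G) :=
  if x is Some a then ((d q a).1, map Some (d q a).2)
  else ((fin q).1, rcons (map Some (fin q).2) None).

Let enc (c : Q * seq G) : Q * seq (option G) := (c.1, map Some c.2 ++ [:: None]).
Let qrun n := iter n (qstep swd h).

Lemma qrun_mealy q w v : ~~ h q ->
  [/\ qrun (size w) (q, map Some w ++ v) = ((mealy q w).1, v ++ map Some (mealy q w).2),
      ~~ h (mealy q w).1 &
      forall i, i <= size w ->
        size (qrun i (q, map Some w ++ v)).2 <= size w + size v + size (mealy q w).2].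
Proof.
elim: w q v => [|a w IH] q v hq.
  by split; rewrite ?cats0 // => -[] // _; rewrite /= addn0.
have [E hq' sz] := IH (d q a).1 (v ++ map Some (d q a).2) (hd a hq).
have S : qstep swd h (q, map Some (a :: w) ++ v) =
  ((d q a).1, map Some w ++ v ++ map Some (d q a).2).
  by rewrite /qstep (negbTE hq) /= catA.
split=> //.
  by rewrite /qrun iterSr S -/(qrun _ _) E map_cat catA.
case=> [_|i i_le].
  by rewrite /= !size_cat size_map; lia.
rewrite /qrun iterSr S; apply: leq_trans (sz i i_le) _.
by rewrite /= !size_cat size_map; lia.
Qed.

Lemma qrun_sweep c : exists2 n, n <= (size c.2).+1 &
  qrun n (enc c) = enc (sweep c) /\
  forall i, i <= n -> size (qrun i (enc c)).2 <= (size c.2 + size (sweep c).2).+1.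
Proof.
case: c => q w; rewrite /sweep /enc /=; case: ifP => hq.
  exists 0 => //; split => // -[] // _; by rewrite size_cat size_map /=; lia.
have [E hq' sz] := qrun_mealy w [:: None] (negbT hq).
case: (mealy q w) E hq' sz => q' w' /= E hq' sz.
have S : qrun (size w).+1 (q, [seq Some i | i <- w] ++ [:: None]) =
    ((fin q').1, [seq Some i | i <- w' ++ (fin q').2] ++ [:: None]).
  by rewrite /qrun iterS -/(qrun _ _) E /qstep (negbTE hq') /= map_cat -cats1 -catA.
exists (size w).+1 => //; split => // i.
rewrite leq_eqVlt => /predU1P[->|i_le]; first by rewrite S /= !size_cat size_map size_cat /=; lia.
by apply: leq_trans (sz i i_le) _; rewrite size_cat /=; lia.
Qed.

Lemma qrun_sweeps c K B : (forall i, i <= K -> size (iter i sweep c).2 <= B) ->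
  exists2 n, n <= K * B.+1 & qrun n (enc c) = enc (iter K sweep c) /\
    forall i, i <= n -> size (qrun i (enc c)).2 <= (2 * B).+1.
Proof.
elim: K => [|K IH] sz.
  by exists 0 => //; split => // -[] // _; have := sz 0 isT; rewrite /= size_cat size_map /=; lia.
have [|n n_le [E szn]] := IH; first by move=> i iK; apply: sz; lia.
have [n' n'_le [E' szn']] := qrun_sweep (iter K sweep c).
have szK : size (iter K sweep c).2 <= B by apply: sz; lia.
have szK' := sz K.+1 (leqnn _); rewrite iterS in szK'.
exists (n' + n); first by rewrite mulSn; lia.
split; first by rewrite /qrun iterD -/(qrun n _) E -/(qrun n' _) E' iterS.
move=> i i_le; case: (leqP i n) => [/szn //|ni].
rewrite -(subnK (ltnW ni)) /qrun iterD -/(qrun n _) E -/(qrun (i - n) _).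
by apply: leq_trans (szn' (i - n) _) _; lia.
Qed.

Section Run.
Variables (A : Type) (inj : A -> G) (q0 : Q) (acc : pred Q).
Hypothesis hq0 : ~~ h q0.
Let M := qtm swd h (Some \o inj) None q0 acc.
Let c w i := iter i sweep (q0, map inj w).

Lemma sweep_tm w K B : h (c w K).1 -> (forall i, i <= K -> size (c w i).2 <= B) ->
  exists n j, [/\ n <= K * B.+1 * (8 * B + 7),
    tm_run M n w = qtape swd h (Some \o inj) None q0 acc (c w K).1 (enc (c w K)).2 j &
    tm_space (tm_run M n w) <= 2 * B + 3].
Proof.
move=> hK sz.
have [N N_le [E szN]] := qrun_sweeps sz.
have N0 : 0 < N.
  case: N E {N_le szN} => // E; case/negP: hq0.
  by move: hK; rewrite /c -[(iter _ _ _).1]/(enc (iter K sweep (q0, map inj w))).1 -E.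
have := @qtm_run Q (option G) swd h A (Some \o inj) None q0 acc w N hq0 N0.
rewrite map_comp -/(enc (q0, map inj w)) => -[n [j [n_le En sp]]].
set B' := \max_(i < N.+1) _ in n_le sp.
have B'_le : B' <= (2 * B).+1 by apply/bigmax_leqP => i _; apply: szN; rewrite -ltnS.
exists n, j; split.
- by apply: leq_trans n_le _; apply: leq_mul => //; lia.
- by rewrite En -/(qrun N _) E.
- by rewrite En; apply: leq_trans sp _; lia.
Qed.

End Run.

(** Space never decreases along a run and is constant after halting, so its value at the halting
    time bounds all others. The number [K] of sweeps is unrestricted; only the word has to stay
    short. *)
Theorem in_PSPACE_sweep (A : finType) (L : seq A -> Prop) (inj : A -> G) q0 (acc : pred Q) C e :
  ~~ h q0 ->
  (forall w, exists K, let c i := iter i sweep (q0, map inj w) in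
     [/\ h (c K).1, acc (c K).1 <-> L w &
         forall i, i <= K -> size (c i).2 <= C * (size w).+1 ^ e]) ->
  in_PSPACE L.
Proof.
move=> hq0 H; exists (qtm swd h (Some \o inj) None q0 acc), ((2 * C + 3) * 2 ^ e + e) => w.
have [K [hK aK sz]] := H w.
have [n [j [n_le E sp]]] := sweep_tm acc hq0 hK sz.
have st : cstate (tm_run (qtm swd h (Some \o inj) None q0 acc) n w) = QFront swd (iter K sweep (q0, map inj w)).1.
  by rewrite E; case: (enc _).2.
split; first by exists n; rewrite st.
move=> m; apply: leq_trans (leq_poly_polyb _ _ _).
have sp' : tm_space (tm_run (qtm swd h (Some \o inj) None q0 acc) n w) <= (2 * C + 3) * (size w).+1 ^ e.
  apply: leq_trans sp _; have : 0 < (size w).+1 ^ e by rewrite expn_gt0.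
  nia.
apply: leq_trans sp'; case: (leqP m n) => [mn|/ltnW mn]; first exact: tm_space_run.
rewrite /tm_run -(subnK mn) iterD -/(tm_run _ n w).
by rewrite tm_halted_run ?st.
Qed.

Theorem poly_time_sweep (A B : finType) (f : seq A -> seq B) (inj : A -> G) (out : G -> option B)
    q0 C e :
  ~~ h q0 ->
  (forall w, exists K, let c i := iter i sweep (q0, map inj w) in
     [/\ K <= C * (size w).+1 ^ e, h (c K).1, pmap out (c K).2 = f w &
         forall i, i <= K -> size (c i).2 <= C * (size w).+1 ^ e]) ->
  poly_time_computable f.
Proof.
move=> hq0 H; pose M := qtm swd h (Some \o inj) None q0 xpredT.
(* The time [K * B.+1 * (8 * B + 7)] is cubic in [(size w).+1 ^ e] when [K] and [B] are multiples of
   that power. *)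
pose k := (C * C.+1 * (8 * C + 7)) * 2 ^ (3 * e) + 3 * e.
exists M, (fun x : tm_sym M => if x.1 is Some (Some a) then out a else None), k => w.
have [K [K_le hK fK sz]] := H w.
have [n [j [n_le E sp]]] := sweep_tm xpredT hq0 hK sz.
have n_k : n <= polyb k (size w).
  apply: leq_trans (leq_poly_polyb _ _ _); apply: leq_trans n_le _.
  rewrite mulnC [3 * e]mulnC expnM; set P := _ ^ e in K_le sz *.
  have P0 : 0 < P by rewrite expn_gt0.
  apply: (@leq_trans ((C * P) * (C.+1 * P) * ((8 * C + 7) * P))); last by rewrite !expnS expn0; nia.
  by rewrite mulnC; apply: leq_mul; [apply: leq_mul|]; nia.
have st : tm_halting M (cstate (tm_run M n w)) by rewrite E; case: (enc _).2.
have -> : tm_run M (polyb k (size w)) w = tm_run M n w.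
  by rewrite /tm_run -(subnK n_k) iterD tm_halted_run.
split=> //; rewrite E -fK /enc /=.
case: (iter K sweep _) => q u /=.
have nb : forall m, pmap (fun x : tm_sym M => if x.1 is Some (Some a) then out a else None)
   (nseq m (None, false)) = [::] by elim.
have mp : forall v, pmap (fun x : tm_sym M => if x.1 is Some (Some a) then out a else None)
   (map (fun a => (Some (Some a), false) : tm_sym M) v) = pmap out v.
  by elim=> //= a v ->.
rewrite /tm_contents; case: u => [|x u] /=; first by rewrite nb.
by rewrite map_cat -map_comp !pmap_cat mp /= nb !cats0.
Qed.
End SweepMachine.

(** * From rewriting systems to walks *)

Lemma Hstep_change (S : finType) (E : rel S) p a b q :
  sorted E (p ++ a :: q) -> sorted E (p ++ b :: q) -> Hstep E (p ++ a :: q) (p ++ b :: q).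
Proof.
move=> Ea Eb; split=> //; first by rewrite !size_cat.
have zz (r : seq S) : count (fun p : S * S => p.1 != p.2) (zip r r) = 0.
  by elim: r => //= x r ->; rewrite eqxx.
by rewrite zip_cat // count_cat zz /= zz; case: (_ != _).
Qed.

Lemma HstepP (S : finType) (E : rel S) u v : Hstep E u v ->
  u = v \/ exists p a b q, [/\ u = p ++ a :: q, v = p ++ b :: q,
    sorted E (p ++ a :: q) & sorted E (p ++ b :: q)].
Proof.
case=> Eu Ev sz ct.
suff : u = v \/ exists p a b q, u = p ++ a :: q /\ v = p ++ b :: q.
  case=> [->|[p [a [b [q [Eu' Ev']]]]]]; first by left.
  by right; exists p, a, b, q; rewrite -Eu' -Ev'.
elim: u v sz ct {Eu Ev} => [|a u IH] [|b v] //=; first by left.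
move=> [sz]; case: eqP => /= [<-|_].
  rewrite add0n => /(IH _ sz) [->|[p [a' [b' [q [-> ->]]]]]]; first by left.
  by right; exists (a :: p), a', b', q.
rewrite ltnS leqn0 => /eqP ct; right; exists [::], a, b, u; split=> //=; congr cons.
elim: u v sz ct {IH} => [|x u IH] [|y v] //= [sz]; case: eqP => //= <- /eqP.
by rewrite add0n => /eqP /(IH _ sz) ->.
Qed.

Lemma Hstep_sym (S : finType) (E : rel S) u v : Hstep E u v -> Hstep E v u.
Proof.
by move=> h; case: (HstepP h) => [e|[p [a [b [q [-> -> Ea Eb]]]]]]; [subst v|exact: (Hstep_change Eb Ea)].
Qed.

Lemma Hreach_sym (S : finType) (E : rel S) u v : Hreach E u v -> Hreach E v u.
Proof.
elim=> {u v} [u v /Hstep_sym uv|u|u v w _ vu _ wv]; [exact: rt_step|exact: rt_refl|].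
exact: rt_trans wv vu.
Qed.

Section Rewriting.
Variables (X : finType) (rl : X -> X -> X -> X -> bool) (ok : rel X) (lb rb : X).
(** In the middle of a rewriting that changes both symbols, the neighbours of the rule letter
    contribute [a] and [d]. As this is not an admissible pair, no plain letter can take the place of
    the rule letter at that moment. *)
Hypothesis rl_ok : forall a b c d, rl a b c d -> ok a d -> a = c \/ b = d.
Hypothesis rl_mix : forall a b c d a' b' c' d', rl a b c d -> rl a' b' c' d' ->
  a != c -> b != d -> (a, d) \in [:: (a', b'); (a', d'); (c', d')] ->
  (a, b, c, d) = (a', b', c', d').
Hypothesis rl_lb : forall a b c d, rl a b c d ->
  [/\ b != lb, d != lb & (a == lb) = (c == lb)].
Hypothesis rl_rb : forall a b c d, rl a b c d ->
  [/\ a != rb, c != rb & (b == rb) = (d == rb)].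

Definition rstep (x y : seq X) : Prop := exists p a b c d q,
  [/\ x = p ++ [:: a, b & q], y = p ++ [:: c, d & q] & rl a b c d].

(* [inl (x, y)] stands for two consecutive symbols [x] and [y].  While the rule
   [ab -> cd] is being applied, [inl (a, b)] is replaced by [inr (a, b, c, d, _)]:
   with phase [false] the right neighbour may switch from [b] to [d], then with
   phase [true] the left one may switch from [a] to [c].  In between, the
   neighbours [a] and [d] must determine the rule: this is [rl_mix]. *)
Definition letter : finType := (X * X + X * X * X * X * bool)%type.

Definition ledge : rel letter := fun u v =>
  match u, v with
  | inl (x, y), inl (y', z) => [&& ok x y, ok y' z & y == y']
  | inl (x, y), inr (a, b, c, d, ph) =>
      [&& ok x y, rl a b c d & (y == a) || ph && (y == c)]
  | inr (a, b, c, d, ph), inl (y, z) =>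
      [&& ok y z, rl a b c d & (y == d) || ~~ ph && (y == b)]
  | inr _, inr _ => false
  end.

Definition reading (v : letter) : X * X := match v with
  | inl p => p | inr (a, b, c, d, ph) => if ph then (c, d) else (a, b) end.

(* The symbol shared by two consecutive letters, as given by the rule letter if
   one of them is a rule letter. *)
Definition shared (u v : letter) : X :=
  if u is inl _ then (reading v).1 else (reading u).2.

Definition decode (u : seq letter) : seq X :=
  if u is a :: w then pairmap shared a w else [::].
Definition lpair x y : letter := inl (x, y).
(** One more border symbol is added at each end, so that every symbol of [x] is shared by two
    letters. The first and last letters have a single neighbour and are thus constrained on one side
    only; what is read there stays fixed because [x] itself begins with [lb] and ends with [rb],
    which no rule alters. *)
Definition encode (x : seq X) : seq letter := pairmap lpair lb (rcons x rb).

Definition bordered (x : seq X) : Prop := exists m, x = lb :: rcons m rb.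
Definition link (x y : seq X) : Prop := [\/ x = y, rstep x y | rstep y x].

Let linkp (s t : X * X) := [\/ s = t, rl s.1 s.2 t.1 t.2 | rl t.1 t.2 s.1 s.2].

Lemma linkp_link p s t q : linkp s t -> link (p ++ [:: s.1, s.2 & q]) (p ++ [:: t.1, t.2 & q]).
Proof.
case=> [->|h|h]; [by constructor 1|constructor 2|constructor 3].
  by exists p, s.1, s.2, t.1, t.2, q.
by exists p, t.1, t.2, s.1, s.2, q.
Qed.

Lemma mid_link x y v z t : ledge (inl (x, y)) v -> ledge v (inl (z, t)) ->
  (linkp (reading v) (y, z)) \/
  exists a b c d ph, [/\ v = inr (a, b, c, d, ph), rl a b c d, (y, z) = (a, d), a != c & b != d].
Proof.
case: v => [[v1 v2]|[[[[a b] c] d] ph]] /=.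
  by move=> /and3P[_ _ /eqP->] /and3P[_ _ /eqP->]; left; constructor.
move=> /and3P[_ r h1] /and3P[_ _ h2].
have [/eqP/pair_eqP/andP[/= /eqP Ey /eqP Ez]|ne] := boolP ((y, z) == (a, d)); last first.
  left; case: ph h1 h2 => /=; rewrite ?orbF.
    move=> h1 /eqP Ez; subst z; case/orP: h1 => /eqP Ey; subst y; last by constructor.
    by rewrite eqxx in ne.
  move=> /eqP Ey h2; subst y; case/orP: h2 => /eqP Ez; subst z; last by constructor.
  by rewrite eqxx in ne.
have [ac|ac] := eqVneq a c.
  by left; subst y z; subst c; case: ph {h1 h2}; [by constructor 1|by constructor 2; exact: r].
have [bd|bd] := eqVneq b d.
  by left; subst y z; subst d; case: ph {h1 h2}; [by constructor 3; exact: r|by constructor 1].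
by right; exists a, b, c, d, ph; rewrite Ey Ez.
Qed.

Lemma mid_mix x y v z t a b c d : ledge (inl (x, y)) v -> ledge v (inl (z, t)) ->
  rl a b c d -> (y, z) = (a, d) -> a != c -> b != d -> exists ph, v = inr (a, b, c, d, ph).
Proof.
case: v => [[v1 v2]|[[[[a' b'] c'] d'] ph]] /=.
  move=> /and3P[_ o /eqP Ey] /and3P[_ _ /eqP Ez] r [Ea Ed] ac bd; subst v1 v2 a d.
  by case: (rl_ok r o) => E; rewrite E eqxx in ac bd.
move=> /and3P[_ r' h1] /and3P[_ _ h2] r [Ey Ez] ac bd; subst a d.
exists ph; suff mem : (y, z) \in [:: (a', b'); (a', d'); (c', d')] by case: (rl_mix r r' ac bd mem) => -> -> -> ->.
rewrite !inE !xpair_eqE; case: ph h1 h2 => /=; rewrite ?orbF.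
  by move=> /orP[] -> ->; rewrite ?orbT.
by move=> -> /orP[] ->; rewrite ?orbT.
Qed.

(** Next to a rule letter only plain pairs can stand, and changing one of them there changes nothing
    that is read. Between plain pairs ending in [y] and beginning with [z], the reading of the
    middle letter is one rule away from [(y, z)], so [(y, z)] links the two versions. The exception
    is [(y, z) = (a, d)] in the middle of a rewriting, where [rl_ok] and [rl_mix] leave only a
    change of phase. *)
Lemma shared_change x v v' z : ledge x v -> ledge v z -> ledge x v' -> ledge v' z ->
  exists m, linkp (shared x v, shared v z) m /\ linkp m (shared x v', shared v' z).
Proof.
case: x => [[x y]|x] xv vz xv' vz'; last first.
  exists (shared (inr x) v, shared v z); split; first by constructor.
  case: v xv vz => [[v1 v2]|v]; last by case: x {xv'} => [[[[? ?] ?] ?] ?].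
  case: v' xv' vz' => [[v1' v2']|v']; last by case: x => [[[[? ?] ?] ?] ?].
  move=> _ h' _ h; constructor 1.
  suff -> : shared (inl (v1, v2)) z = shared (inl (v1', v2')) z by [].
  by case: z h h' => [[z t]|[[[[a b] c] d] ph]] //=; move=> /and3P[_ _ /eqP->] /and3P[_ _ /eqP->].
case: z vz vz' => [[z t]|z] vz vz'; last first.
  exists (shared (inl (x, y)) v, shared v (inr z)); split; first by constructor.
  case: v xv vz => [[v1 v2]|[[[[? ?] ?] ?] ?]]; last by [].
  case: v' xv' vz' => [[v1' v2']|[[[[? ?] ?] ?] ?]]; last by [].
  by move=> /= /and3P[_ _ /eqP->] _ /and3P[_ _ /eqP->] _; constructor 1.
have rd u : ledge (inl (x, y)) u -> ledge u (inl (z, t)) ->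
    (shared (inl (x, y)) u, shared u (inl (z, t))) = reading u.
  by case: u => [[u1 u2]|u] //=; rewrite -?surjective_pairing // => _ /and3P[_ _ /eqP->].
rewrite !rd //.
have [l|[a [b [c [d [ph [Ev r E ac bd]]]]]]] := mid_link xv vz; last first.
  have [ph' Ev'] := mid_mix xv' vz' r E ac bd.
  rewrite Ev Ev' /=; exists (a, b); case: ph {Ev}; case: ph' {Ev'}; split;
    by [constructor 1|constructor 2|constructor 3].
have [l'|[a [b [c [d [ph [Ev' r E ac bd]]]]]]] := mid_link xv' vz'.
  exists (y, z); split => //; by case: l'; [constructor 1|constructor 3|constructor 2].
have [ph' Ev] := mid_mix xv vz r E ac bd.
rewrite Ev Ev' /=; exists (a, b); case: ph {Ev'}; case: ph' {Ev}; split;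
    by [constructor 1|constructor 2|constructor 3].
Qed.

Lemma shared_lb v v' z : ledge v z -> ledge v' z -> shared v z = lb -> shared v' z = lb.
Proof.
case: z => [[z t]|[[[[a b] c] d] ph]].
  case: v => [[v1 v2]|[[[[a b] c] d] ph]] /=; last first.
    by move=> /and3P[_ /rl_lb[/eqP nb /eqP nd _] _] _; case: ph.
  move=> _ h E; subst z; case: v' h => [[]|[[[[a b] c] d] ph]] //=.
  by move=> /and3P[_ /rl_lb[/negbTE nb /negbTE nd _]]; rewrite ![lb == _]eq_sym nb nd andbF.
by case: v => [[v1 v2]|[[[[? ?] ?] ?] ?]] //; case: v' => [[]|[[[[? ?] ?] ?] ?]].
Qed.

Lemma shared_rb x v v' : ledge x v -> ledge x v' -> shared x v = rb -> shared x v' = rb.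
Proof.
case: x => [[x y]|[[[[a b] c] d] ph]] //=.
case: v => [[v1 v2]|[[[[a b] c] d] ph]] /=; last first.
  by move=> /and3P[_ /rl_rb[/eqP na /eqP nc _] _] _; case: ph.
move=> /and3P[_ _ /eqP E] h E'; subst v1 y; case: v' h => [[v1' v2']|[[[[a b] c] d] ph]] /=.
  by case/and3P=> _ _ /eqP.
by move=> /and3P[_ /rl_rb[/negbTE na /negbTE nc _]]; rewrite ![rb == _]eq_sym na nc andbF.
Qed.

Lemma decode_mid p x v z q : decode (p ++ [:: x, v, z & q]) =
  decode (rcons p x) ++ [:: shared x v, shared v z & pairmap shared z q].
Proof.
case: p => [|y p] //=.
by rewrite pairmap_cat /= -cats1 pairmap_cat /= -catA.
Qed.

Lemma sorted_mid (e : rel letter) p x v z q :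
  sorted e (p ++ [:: x, v, z & q]) = [&& sorted e (rcons p x), e x v, e v z & path e z q].
Proof. by case: p => [|y p] //=; rewrite -cat_rcons cat_path last_rcons. Qed.

Lemma sorted_last2 (e : rel letter) p x v :
  sorted e (rcons (rcons p x) v) = sorted e (rcons p x) && e x v.
Proof. by case: p => [|y p] //=; rewrite ?andbT // !rcons_path last_rcons. Qed.

Lemma decode_last2 p x v : decode (rcons (rcons p x) v) = rcons (decode (rcons p x)) (shared x v).
Proof.
case: p => [|y p] //=.
by rewrite -!cats1 !pairmap_cat /= last_cat.
Qed.

Lemma Hstep_decode u v : Hstep ledge u v -> bordered (decode u) ->
  exists m, link (decode u) m /\ link m (decode v).
Proof.
case/HstepP=> [->|[p [a [b [q [-> -> Ea Eb]]]]]].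
  by move=> _; exists (decode v); split; constructor.
move=> [m]; case/lastP: p Ea Eb => [|p x]; case: q => [|z q].
- by [].
- move=> /= /andP[az _] /andP[bz _] [Ea _].
  exists (shared b z :: pairmap shared z q); split; constructor => //=.
  by rewrite Ea (shared_lb az bz Ea).
- rewrite !cats1 !sorted_last2 !decode_last2 => /andP[_ xa] /andP[_ xb].
  rewrite -rcons_cons => /rcons_inj[_ Ea]; exists (decode (rcons (rcons p x) b)).
  by rewrite decode_last2 Ea (shared_rb xa xb Ea); split; constructor.
rewrite !cat_rcons !sorted_mid !decode_mid => /and4P[_ xa az _] /and4P[_ xb bz _] _.
have [s [h1 h2]] := shared_change xa az xb bz.
exists (decode (rcons p x) ++ [:: s.1, s.2 & pairmap shared z q]); split.
  exact: (linkp_link _ _ h1).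
exact: (linkp_link _ _ h2).
Qed.

Lemma rstep_bordered x y : rstep x y -> bordered x <-> bordered y.
Proof.
case=> [p [a [b [c [d [q [-> -> r]]]]]]].
have [/negbTE bl /negbTE dl Elb] := rl_lb r; have [/negbTE ar /negbTE cr Erb] := rl_rb r.
have bE w : bordered w <-> [&& 1 < size w, head rb w == lb & last lb w == rb].
  split=> [[m ->]|]; first by rewrite /= size_rcons last_rcons !eqxx.
  case: w => [|e w] //; case/lastP: w => [|w e'] //=.
  by rewrite last_rcons => /and3P[_ /eqP-> /eqP->]; exists w.
rewrite !bE !size_cat !last_cat /=.
have -> : head rb (p ++ [:: a, b & q]) == lb = (head rb (p ++ [:: c, d & q]) == lb).
  by case: p.
suff -> : (last b q == rb) = (last d q == rb) by [].
by case: q.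
Qed.

Lemma link_bordered x y : link x y -> bordered x -> bordered y.
Proof. by case=> [->|/rstep_bordered h|/rstep_bordered h] // /h. Qed.

Lemma decode_encode x : decode (encode x) = x.
Proof.
rewrite /encode; case: x => [|a x] //=.
by move: (lb) => l; elim: x a l => [|b x IH] a l //=; rewrite IH.
Qed.

Lemma sorted_encode x : path ok lb (rcons x rb) -> sorted ledge (encode x).
Proof.
rewrite /encode; case: x => [|a x] //=.
move: (lb) => l; elim: x a l => [|b x IH] a l /= /and3P[la ab].
  by rewrite la ab eqxx.
by move=> h; rewrite la ab eqxx /=; apply: (IH b a); rewrite ab.
Qed.

Lemma rstep_Hreach x y : rstep x y -> path ok lb (rcons x rb) -> path ok lb (rcons y rb) ->
  Hreach ledge (encode x) (encode y).
Proof.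
case=> [p [a [b [c [d [q [-> -> r]]]]]]] ok1 ok2.
(* The added [rb] ensures that some symbol [e] follows the rewritten pair, hence that the rule
   letter has a right neighbour. *)
case Eq: (rcons q rb) => [|e q']; first by case: q Eq {ok1 ok2}.
pose P := pairmap lpair lb p; pose l := last lb p; pose R := pairmap lpair e q'.
have enc x1 x2 : encode (p ++ [:: x1, x2 & q]) = P ++ [:: lpair l x1, lpair x1 x2, lpair x2 e & R].
  by rewrite /encode rcons_cat pairmap_cat /= Eq.
move: (sorted_encode ok1) (sorted_encode ok2); rewrite !enc.
move: ok1 ok2; rewrite !rcons_cat !cat_path /= Eq /= -/l.
move=> /and5P[_ la ab be _] /and5P[_ lc cd de _] S1 S2.
pose v ph : letter := inr (a, b, c, d, ph).
have mix x1 x2 x3 x4 x5 x6 : sorted ledge (P ++ [:: lpair l x1, x2, lpair x3 e & R]) ->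
    sorted ledge (P ++ [:: lpair l x4, x5, lpair x6 e & R]) -> 
    [/\ sorted ledge (rcons P (lpair l x1)), sorted ledge (rcons P (lpair l x4)),
       path ledge (lpair x3 e) R & path ledge (lpair x6 e) R].
  by rewrite !sorted_mid => /and4P[-> _ _ ->] /and4P[-> _ _ ->].
have [Pa Pc bR dR] := mix _ _ _ _ _ _ S1 S2.
have S x1 x3 ph : sorted ledge (rcons P (lpair l x1)) -> path ledge (lpair x3 e) R ->
    ok l x1 -> ok x3 e -> (x1 == a) || ph && (x1 == c) -> (x3 == d) || ~~ ph && (x3 == b) ->
    sorted ledge (P ++ [:: lpair l x1, v ph, lpair x3 e & R]).
  by rewrite sorted_mid /= r => -> -> -> -> -> ->.
pose w1 := P ++ [:: lpair l a, v false, lpair b e & R].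
pose w2 := P ++ [:: lpair l a, v false, lpair d e & R].
pose w3 := P ++ [:: lpair l a, v true, lpair d e & R].
pose w4 := P ++ [:: lpair l c, v true, lpair d e & R].
have V1 : sorted ledge w1 by apply: S; rewrite ?eqxx ?orbT.
have V2 : sorted ledge w2 by apply: S; rewrite ?eqxx ?orbT.
have V3 : sorted ledge w3 by apply: S; rewrite ?eqxx ?orbT.
have V4 : sorted ledge w4 by apply: S; rewrite ?eqxx ?orbT.
have step1 p' x1 x2 q1 : sorted ledge (p' ++ x1 :: q1) -> sorted ledge (p' ++ x2 :: q1) ->
  Hreach ledge (p' ++ x1 :: q1) (p' ++ x2 :: q1).
  by move=> h1 h2; apply/rt_step/Hstep_change.
apply: (rt_trans _ _ _ w1).
  by move: S1 V1; rewrite /w1 -!(cat_rcons (lpair l a)); apply: step1.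
apply: (rt_trans _ _ _ w2).
  move: V1 V2; rewrite /w1 /w2 -!(cat_rcons (lpair l a)) -!(cat_rcons (v false)); exact: step1.
apply: (rt_trans _ _ _ w3).
  by move: V2 V3; rewrite /w2 /w3 -!(cat_rcons (lpair l a)); apply: step1.
apply: (rt_trans _ _ _ w4); first exact: step1.
by move: V4 S2; rewrite /w4 -!(cat_rcons (lpair l c)); apply: step1.
Qed.
End Rewriting.

(** * Shuttle machines *)

Section Base.
Variables (P G : Type).
(* A letter [Lt a] is left of the head, [Rt a] is right of it; [Hr p o] and
   [Hl p o] are heads in state [p] moving right and left, and [o] records the
   last letter read, which makes every rule recoverable from its two heads. *)
Inductive base := Lend | Rend | Lt of G | Rt of G | Hr of P & option G | Hl of P & option G.
Definition base_code x := match x with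
  | Lend => inl (inl true) | Rend => inl (inl false)
  | Lt a => inl (inr (true, a)) | Rt a => inl (inr (false, a))
  | Hr p o => inr (true, p, o) | Hl p o => inr (false, p, o) end.
Definition base_decode x := match x with
  | inl (inl true) => Lend | inl (inl false) => Rend
  | inl (inr (true, a)) => Lt a | inl (inr (false, a)) => Rt a
  | inr (true, p, o) => Hr p o | inr (false, p, o) => Hl p o end.
Lemma base_codeK : cancel base_code base_decode. Proof. by case. Qed.
End Base.
Arguments Lend {P G}. Arguments Rend {P G}. Arguments Lt {P G}. Arguments Rt {P G}.
HB.instance Definition _ (P G : eqType) := Equality.copy (base P G) (can_type (@base_codeK P G)).
HB.instance Definition _ (P G : choiceType) := Choice.copy (base P G) (can_type (@base_codeK P G)).
HB.instance Definition _ (P G : countType) := Countable.copy (base P G) (can_type (@base_codeK P G)).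
HB.instance Definition _ (P G : finType) := Finite.copy (base P G) (can_type (@base_codeK P G)).

Section Shuttle.
Variables (P G : finType) (dr dl : P -> G -> G * P) (tr tl : P -> P) (er : P) (z : G).
Let X := base P G.

(** The only head without a move at an end marker is one in state [er] before [Rend]: this is where
    the machine gets stuck. *)
Definition rwr (x y : X) : option (X * X) := match x, y with
  | Hr p _, Rt a => Some (Lt (dr p a).1, Hr (dr p a).2 (Some a))
  | Hr p _, Rend => if p == er then None else Some (Hl (tr p) None, Rend)
  | _, _ => None end.
Definition rwl (x y : X) : option (X * X) := match x, y with
  | Lt a, Hl p _ => Some (Hl (dl p a).2 (Some a), Rt (dl p a).1)
  | Lend, Hl p _ => Some (Lend, Hr (tl p) None)
  | _, _ => None end.
(* Leftward rules are reversed, so that in each rule [ab -> cd] which changes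
   both symbols, [a] and [d] are heads. *)
Definition srule (a b c d : X) : bool := (rwr a b == Some (c, d)) || (rwl c d == Some (a, b)).
Definition is_head (x : X) := match x with Hr _ _ | Hl _ _ => true | _ => false end.
Definition sok (x y : X) : bool := match x, y with
  | Lt _, Rt _ => false | _, _ => ~~ (is_head x && is_head y) end.

Inductive srule_spec : X -> X -> X -> X -> Prop :=
  | Srule_r p o a : srule_spec (Hr p o) (Rt a) (Lt (dr p a).1) (Hr (dr p a).2 (Some a))
  | Srule_tr p o : p != er -> srule_spec (Hr p o) Rend (Hl (tr p) None) Rend
  | Srule_l p o a : srule_spec (Hl (dl p a).2 (Some a)) (Rt (dl p a).1) (Lt a) (Hl p o)
  | Srule_tl p o : srule_spec Lend (Hr (tl p) None) Lend (Hl p o).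

Lemma sruleP a b c d : srule a b c d -> srule_spec a b c d.
Proof.
case/orP => /eqP.
  case: a => //= p o; case: b => //= [|x].
    by case: ifPn => // pe [<- <-]; constructor.
  by case=> <- <-; constructor.
case: c => //= [|x]; case: d => //= p o [<- <-]; constructor.
Qed.

Lemma srule_ok a b c d : srule a b c d -> sok a d -> a = c \/ b = d.
Proof. by case/sruleP => //; auto. Qed.

(** Of the three pairs only [(a', d')] can consist of two heads. The later of these names the letter
    just read, the earlier one the state in which it was read, and together they are the whole
    rule. *)
Lemma srule_mix a b c d a' b' c' d' : srule a b c d -> srule a' b' c' d' ->
  a != c -> b != d -> (a, d) \in [:: (a', b'); (a', d'); (c', d')] ->
  (a, b, c, d) = (a', b', c', d').
Proof.
rewrite !inE => /sruleP[p o x|p o _|p o x|p o] /sruleP[p' o' x'|p' o' _|p' o' x'|p' o'];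
  rewrite ?eqxx // => _ _ /or3P[] /eqP // [] *; subst; by [].
Qed.

Lemma srule_Lend a b c d : srule a b c d ->
  [/\ b != Lend, d != Lend & (a == Lend) = (c == Lend)].
Proof. by case/sruleP. Qed.

Lemma srule_Rend a b c d : srule a b c d ->
  [/\ a != Rend, c != Rend & (b == Rend) = (d == Rend)].
Proof. by case/sruleP. Qed.

(** The machine's own direction of time, whereas in [rstep srule] the leftward moves run
    backwards. *)
Definition fwd (x y : seq X) : Prop := exists p a b c d q,
  [/\ x = p ++ [:: a, b & q], y = p ++ [:: c, d & q] &
      (rwr a b == Some (c, d)) || (rwl a b == Some (c, d))].

Lemma rstep_fwd x y : rstep srule x y -> fwd x y \/ fwd y x.
Proof.
case=> p [a [b [c [d [q [-> -> /orP[] h]]]]]]; [left|right].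
  by exists p, a, b, c, d, q; rewrite h.
by exists p, c, d, a, b, q; rewrite h orbT.
Qed.

Lemma fwd_rstep x y : fwd x y -> rstep srule x y \/ rstep srule y x.
Proof.
case=> p [a [b [c [d [q [-> -> /orP[] h]]]]]]; [left|right].
  by exists p, a, b, c, d, q; rewrite /srule h.
by exists p, c, d, a, b, q; rewrite /srule h orbT.
Qed.

Lemma count1_split (T : Type) (h : pred T) p1 x1 q1 p2 x2 q2 :
  p1 ++ x1 :: q1 = p2 ++ x2 :: q2 -> h x1 -> h x2 -> count h (p1 ++ x1 :: q1) = 1 ->
  [/\ p1 = p2, x1 = x2 & q1 = q2].
Proof.
elim: p1 p2 => [|y p1 IH] [|y2 p2] //=.
- by move=> [-> ->].
- by move=> [<- ->] -> h2; rewrite count_cat /= h2; lia.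
- by move=> [<- <-] h1 ->; rewrite count_cat /= h1; lia.
move=> [<- E] h1 h2; case hy: (h y); first by rewrite count_cat /= h1; lia.
by rewrite add0n => /(IH _ E h1 h2) [-> -> ->].
Qed.

(** The single head fixes the pair to be rewritten: a head moving right is its left member, a head
    moving left its right member. *)
Lemma fwd_det x y1 y2 : count is_head x = 1 -> fwd x y1 -> fwd x y2 -> y1 = y2.
Proof.
move=> ct [p1 [a1 [b1 [c1 [d1 [q1 [E1 -> h1]]]]]]] [p2 [a2 [b2 [c2 [d2 [q2 [E2 -> h2]]]]]]].
have hd a b c d : (rwr a b == Some (c, d)) || (rwl a b == Some (c, d)) ->
  exists h : bool, is_head (if h then b else a) /\
    (if h then exists p o, b = Hl p o else exists p o, a = Hr p o).
  case/orP; case: a => //; case: b => //.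
  - by move=> p o _; exists false; split => //; exists p, o.
  - by move=> g p o _; exists false; split => //; exists p, o.
  - by move=> p o _; exists true; split => //; exists p, o.
  - by move=> p o g _; exists true; split => //; exists p, o.
have [g1 [hg1 k1]] := hd _ _ _ _ h1; have [g2 [hg2 k2]] := hd _ _ _ _ h2.
have [E [F1 F2]] : p1 = p2 /\ a1 = a2 /\ b1 :: q1 = b2 :: q2.
  case: g1 hg1 k1 => hg1 k1; case: g2 hg2 k2 => hg2 k2.
  - move: E1 E2 ct; rewrite -cat_rcons -[p2 ++ _]cat_rcons => -> E ct.
    by have [/rcons_inj[-> ->] -> ->] := count1_split E hg1 hg2 ct.
  - move: E1 E2 ct; rewrite -cat_rcons => -> E ct.
    have [_ Eb _] := count1_split E hg1 hg2 ct.
    by case: k1 k2 => [? [? ]] + [? [? ]]; rewrite Eb => ->.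
  - move: E1 E2 ct; rewrite -[p2 ++ _]cat_rcons => -> E ct.
    have [_ Eb _] := count1_split E hg1 hg2 ct.
    by case: k1 k2 => [? [? ]] + [? [? ]]; rewrite Eb => ->.
  - by move: E1 E2 ct => -> E ct; have [-> -> ->] := count1_split E hg1 hg2 ct.
case: F2 => Eb Eq; subst a2 b2 q2 p2.
move: h1 h2; case Er: (rwr a1 b1) => [r|]; case El: (rwl a1 b1) => [r'|] //=.
- by case: a1 Er El {E1 E2 hg1 hg2 k1 k2}.
- by rewrite !orbF => /eqP[->] /eqP[-> ->].
- by move=> /eqP[->] /eqP[-> ->].
Qed.

Lemma fwd_count x y : fwd x y -> count is_head x = count is_head y.
Proof.
case=> p [a [b [c [d [q [-> -> h]]]]]]; rewrite !count_cat /=.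
suff : is_head a + is_head b = is_head c + is_head d by lia.
case/orP: h => /eqP; case: a => //=; case: b => //=.
- by move=> p' o; case: ifP => // _ [<- <-].
- by move=> x' p' o [<- <-].
- by move=> p' o [<- <-].
- by move=> p' o x' [<- <-].
Qed.

Fixpoint steps n x y := if n is n'.+1 then exists2 x', fwd x x' & steps n' x' y else x = y.

Lemma steps_trans m n x y w : steps m x y -> steps n y w -> steps (m + n) x w.
Proof. by elim: m x => [|m IH] x /= => [->|[x' f h]] // /(IH _ h); exists x'. Qed.

Lemma steps_terminal m n x y t : count is_head x = 1 -> (forall y', ~ fwd t y') ->
  steps m x t -> steps n x y -> n <= m.
Proof.
move=> + tt; elim: m n x => [|m IH] [|n] x //= ct.
  by move=> -> [x' /tt].
move=> [x1 f1 h1] [x2 f2]; rewrite -(fwd_det ct f1 f2).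
by apply: IH => //; rewrite -(fwd_count f1).
Qed.

Definition sedge : rel (letter X) := ledge srule sok.
Definition sencode : seq X -> seq (letter X) := encode Lend Rend.

(** Having a run to the terminal word [t] is invariant under links in both directions: a step into
    the current word prolongs the run, and a step out of it must, by determinism, be the first step
    of the run, which is not empty because [t] allows no step. *)
Lemma Hreach_steps u v t : Hreach sedge u v -> (forall y', ~ fwd t y') ->
  bordered Lend Rend (decode v) -> count is_head (decode v) = 1 ->
  (exists n, steps n (decode v) t) ->
  [/\ bordered Lend Rend (decode u), count is_head (decode u) = 1 &
      exists n, steps n (decode u) t].
Proof.
move=> H tt; elim: H => {u v} [u v uv|u|u v w _ IH1 _ IH2] // bv cv Sv; last first.
  by have [b c S] := IH2 bv cv Sv; apply: IH1.
have lk x y : link srule x y ->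
    [/\ bordered Lend Rend x, count is_head x = 1 & exists n, steps n x t] ->
    [/\ bordered Lend Rend y, count is_head y = 1 & exists n, steps n y t].
  move=> l [bx cx [n Sx]]; split; first by apply: link_bordered l bx; [apply: srule_Lend|apply: srule_Rend].
    by case: l => [<- //|/rstep_fwd[]|/rstep_fwd[]] /fwd_count; rewrite cx.
  have [<-|[f|f]] : x = y \/ (fwd x y \/ fwd y x).
    by case: l => [->|/rstep_fwd|/rstep_fwd[]]; auto.
  - by exists n.
  - case: n Sx => [/= E|n [x' f' h]]; first by case: (tt y); rewrite -E.
    by exists n; rewrite (fwd_det cx f f').
  - by exists n.+1, x.
have [m [l1 l2]] := Hstep_decode srule_ok srule_mix srule_Lend srule_Rend (Hstep_sym uv) bv.
by apply: (lk m) => //; apply: (lk (decode v)).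
Qed.

Definition bword (l : seq G) (h : X) (r : seq G) : seq X :=
  Lend :: map Lt (rev l) ++ h :: rcons (map Rt r) Rend.

Lemma bword_ok l h r : is_head h -> path sok Lend (rcons (bword l h r) Rend).
Proof.
move=> hh; rewrite /bword /= rcons_cat cat_path /=.
have hL (v : seq G) a : path sok (Lt a) (map Lt v) by elim: v a => //= b v IH a.
have -> : path sok Lend (map Lt (rev l)) by case: (rev l) => //= a v.
have -> : sok (last Lend (map Lt (rev l))) h.
  by case/lastP: (rev l) => [|v a]; rewrite ?map_rcons ?last_rcons; case: h hh.
have hR (v : seq G) a : path sok (Rt a) (rcons (rcons (map Rt v) Rend) Rend).
  by elim: v a => //= b v IH a.
by case: r => [|a r] /=; rewrite ?hR; case: h hh.
Qed.

(** Acceptance needs the walk and rejection needs the number of machine steps, so both are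
    established together. *)
Definition good n x y := steps n x y /\ Hreach sedge (sencode x) (sencode y).

Lemma good_trans m n x y w : good m x y -> good n y w -> good (m + n) x w.
Proof. by move=> [s1 h1] [s2 h2]; split; [apply: steps_trans s2|apply: rt_trans h2]. Qed.

Lemma good_fwd l h r l' h' r' : is_head h -> is_head h' ->
  fwd (bword l h r) (bword l' h' r') -> good 1 (bword l h r) (bword l' h' r').
Proof.
move=> hh hh' f; split; first by exists (bword l' h' r').
case: (fwd_rstep f) => rs; last apply: Hreach_sym;
  by apply: rstep_Hreach rs _ _; apply: bword_ok.
Qed.

Lemma good_r l p o a r :
  good 1 (bword l (Hr p o) (a :: r)) (bword ((dr p a).1 :: l) (Hr (dr p a).2 (Some a)) r).
Proof.
apply: good_fwd => //; exists (Lend :: map Lt (rev l)), (Hr p o), (Rt a), (Lt (dr p a).1),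
  (Hr (dr p a).2 (Some a)), (rcons (map Rt r) Rend); split; rewrite ?eqxx //.
by rewrite /bword rev_cons map_rcons cat_rcons.
Qed.

Lemma good_l l p o a r :
  good 1 (bword (a :: l) (Hl p o) r) (bword l (Hl (dl p a).2 (Some a)) ((dl p a).1 :: r)).
Proof.
apply: good_fwd => //; exists (Lend :: map Lt (rev l)), (Lt a), (Hl p o),
  (Hl (dl p a).2 (Some a)), (Rt (dl p a).1), (rcons (map Rt r) Rend); split; rewrite ?eqxx ?orbT //.
by rewrite /bword rev_cons map_rcons cat_rcons.
Qed.

Lemma good_tr l p o : p != er -> good 1 (bword l (Hr p o) [::]) (bword l (Hl (tr p) None) [::]).
Proof.
move=> pe; apply: good_fwd => //; exists (Lend :: map Lt (rev l)), (Hr p o), Rend,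
  (Hl (tr p) None), Rend, [::]; split=> //.
by rewrite /= (negbTE pe) eqxx.
Qed.

Lemma good_tl p o r : good 1 (bword [::] (Hl p o) r) (bword [::] (Hr (tl p) None) r).
Proof.
apply: good_fwd => //; exists [::], Lend, (Hl p o), Lend, (Hr (tl p) None), (rcons (map Rt r) Rend).
by split; rewrite //= eqxx.
Qed.

Fixpoint smealy (d : P -> G -> G * P) p w : P * seq G :=
  if w is a :: w' then ((smealy d (d p a).2 w').1, (d p a).1 :: (smealy d (d p a).2 w').2)
  else (p, [::]).

Lemma size_smealy d p w : size (smealy d p w).2 = size w.
Proof. by elim: w p => //= a w IH p; rewrite IH. Qed.

Lemma smealy_cat d p v w : smealy d p (v ++ w) =
  ((smealy d (smealy d p v).1 w).1, (smealy d p v).2 ++ (smealy d (smealy d p v).1 w).2).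
Proof. by elim: v p => [|a v IH] p /=; [case: smealy|rewrite IH]. Qed.

Lemma good_mealy_r l p o w : exists o', good (size w) (bword l (Hr p o) w)
  (bword (catrev (smealy dr p w).2 l) (Hr (smealy dr p w).1 o') [::]).
Proof.
elim: w l p o => [|a w IH] l p o; first by exists o; split => //; apply: rt_refl.
have [o' g] := IH ((dr p a).1 :: l) (dr p a).2 (Some a).
by exists o'; apply: (good_trans (good_r l p o a w) g).
Qed.

Lemma good_mealy_l p o w r : exists o', good (size w) (bword w (Hl p o) r)
  (bword [::] (Hl (smealy dl p w).1 o') (catrev (smealy dl p w).2 r)).
Proof.
elim: w p o r => [|a w IH] p o r; first by exists o; split => //; apply: rt_refl.
have [o' g] := IH (dl p a).2 (Some a) ((dl p a).1 :: r).
by exists o'; apply: (good_trans (good_l w p o a r) g).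
Qed.

Definition shuttle (c : P * seq G) : P * seq G :=
  if c.1 == er then c else
  let: (p, u) := smealy dr c.1 c.2 in let: (q, v) := smealy dl (tr p) (rev u) in (tl q, rev v).

(** A rightward sweep begun outside [er] can therefore turn at the right end; the machine stops only
    in a sweep that starts in [er]. *)
Hypothesis dr_er : forall p a, p != er -> (dr p a).2 != er.
Hypothesis dr_erase : forall a, dr er a = (z, er).

Lemma size_shuttle c : size (shuttle c).2 = size c.2.
Proof.
rewrite /shuttle; case: ifP => // _.
have := size_smealy dr c.1 c.2; case: (smealy dr _ _) => p u /= <-.
have := size_smealy dl (tr p) (rev u); case: (smealy dl _ _) => q v /=.
by rewrite !size_rev.
Qed.

Lemma good_shuttle p w : p != er -> exists2 n, 0 < n &
  good n (bword [::] (Hr p None) w) (bword [::] (Hr (shuttle (p, w)).1 None) (shuttle (p, w)).2).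
Proof.
move=> pe; rewrite /shuttle /= (negbTE pe).
have [o] := good_mealy_r [::] p None w.
have : (smealy dr p w).1 != er by elim: w p pe => //= a w IH p pe; apply/IH/dr_er.
case: (smealy dr p w) => p1 u /= pe1 g1.
have [o2] := good_mealy_l (tr p1) None (rev u) [::].
case: (smealy dl _ _) => p2 v /= g2; rewrite -/(rev u) -/(rev v) in g1 g2.
have g := good_trans (good_trans g1 (good_tr (rev u) o pe1)) (good_trans g2 (good_tl p2 o2 (rev v))).
by exists (size w + 1 + (size (rev u) + 1)) => //; rewrite addn1 addSn.
Qed.

Lemma good_shuttles p w n : (forall i, i < n -> (iter i shuttle (p, w)).1 != er) ->
  let c := iter n shuttle (p, w) in
  exists2 m, n <= m & good m (bword [::] (Hr p None) w) (bword [::] (Hr c.1 None) c.2).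
Proof.
elim: n => [|n IH] ne; first by exists 0 => //; split => //; apply: rt_refl.
have [|m nm g] := IH; first by move=> i i_n; apply: ne; lia.
have [m' m'0 g'] := good_shuttle (iter n shuttle (p, w)).2 (ne n (leqnn _)).
rewrite -surjective_pairing -iterS in g'.
by exists (m + m'); [lia|apply: good_trans g'].
Qed.

(** The unique stuck word for rows of [m.+1] letters. As the row is not empty, the head has just
    read a [z], whence [Some z]. *)
Definition final m : seq X := bword (nseq m.+1 z) (Hr er (Some z)) [::].

Theorem shuttle_accept p w n m : iter n shuttle (p, w) = (er, nseq m.+1 z) ->
  Hreach sedge (sencode (bword [::] (Hr p None) w)) (sencode (final m)).
Proof.
move=> E; have [k Ek mk] : exists2 k, (iter k shuttle (p, w)) = (er, nseq m.+1 z) &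
    (forall i, i < k -> (iter i shuttle (p, w)).1 != er).
  elim: n E => [|n IH] E; first by exists 0.
  have [e|e] := eqVneq (iter n shuttle (p, w)).1 er.
    by apply: IH; move: E; rewrite iterS /shuttle e eqxx.
  exists n.+1 => // i; rewrite ltnS leq_eqVlt => /predU1P[-> //|i_n].
  apply: contra_neq e => e; rewrite -(subnK (ltnW i_n)) iterD.
  by elim: (n - i) => //= j IHj; rewrite /shuttle IHj eqxx.
have [j _ [_ g]] := good_shuttles mk; apply: rt_trans g _; rewrite Ek /=.
(* While [shuttle] idles in [er], the machine itself makes one last rightward sweep over letters
   that are already [z]. *)
have erase l i o : Hreach sedge (sencode (bword l (Hr er o) (nseq i.+1 z)))
    (sencode (bword (nseq i.+1 z ++ l) (Hr er (Some z)) [::])).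
  elim: i l o => [|i IH] l o.
    by have [_] := good_r l er o z [::]; rewrite dr_erase.
  have [_] := good_r l er o z (nseq i.+1 z); rewrite dr_erase /= => h.
  apply: rt_trans h _; have := IH (z :: l) (Some z).
  by have cz j0 : nseq j0 z ++ z :: l = z :: nseq j0 z ++ l; [elim: j0 => //= j0 -> | rewrite cz].
by have := erase [::] m None; rewrite cats0.
Qed.

(** A walk would yield a run of some length [N] ending in the stuck word, but [N.+1] rounds of the
    shuttle give a longer run from the same word. *)
Theorem shuttle_reject p w m : (forall n, (iter n shuttle (p, w)).1 != er) ->
  ~ Hreach sedge (sencode (bword [::] (Hr p None) w)) (sencode (final m)).
Proof.
move=> ne h.
have bw l hd r : is_head hd -> count is_head (bword l hd r) = 1.
  move=> hh; rewrite /bword /= count_cat /= hh -cats1 count_cat /= !addn0 add0n.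
  have c0 f (v : seq G) : (forall a, is_head (f a) = false) -> count is_head (map f v) = 0.
    by move=> hf; elim: v => //= a v ->; rewrite hf.
  by rewrite !c0.
have tt y : ~ fwd (final m) y.
  case=> a [x1 [x2 [x3 [x4 [b [E _ r]]]]]].
  have := bw (nseq m.+1 z) (Hr er (Some z)) [::] isT; rewrite -/(final m) => ct.
  have split1 c hd d : final m = c ++ hd :: d -> is_head hd -> hd = Hr er (Some z) /\ d = [:: Rend].
    rewrite /final /bword -cat_cons => E' hh.
    by have [_ <- <-] := count1_split E' isT hh ct.
  case: x1 r E => // [|g|p1 o] r E.
  - case: x2 r E => //= p2 o2 _ E.
    by have [] := split1 (rcons a Lend) (Hl p2 o2) b; rewrite ?cat_rcons.
  - case: x2 r E => //= p2 o2 _ E.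
    by have [] := split1 (rcons a (Lt g)) (Hl p2 o2) b; rewrite ?cat_rcons.
  - have [[Ep _] [Ex _]] := split1 _ _ _ E isT.
    by move: r; rewrite Ex Ep /= eqxx.
have [|||_ _ [N st]] := Hreach_steps h tt.
- rewrite /sencode decode_encode /final; exists (map Lt (rev (nseq m.+1 z)) ++ [:: Hr er (Some z)]).
  by rewrite /bword /= rcons_cat.
- by rewrite /sencode decode_encode bw.
- by rewrite /sencode decode_encode; exists 0.
rewrite /sencode decode_encode in st.
have [M NM [g _]] := good_shuttles (fun i (_ : i < N.+1) => ne i).
have := steps_terminal (bw [::] (Hr p None) w isT) tt st g; lia.
Qed.
End Shuttle.

(** * A programmable shuttle machine *)

(* An instruction acts on a carry (first component) and a stored bit, once in
   the rightward sweep, where [None] means acceptance, and once in the leftward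
   sweep. *)
Definition instr : finType :=
  ({ffun bool * bool -> option (bool * bool)} * {ffun bool * bool -> bool * bool})%type.
Definition nop : instr := ([ffun p => Some p], [ffun p => p]).

(* A slot is a block [SD o1, SI o2, ..., SI ok, SX _ x] made of a bit [x] and a
   cyclic list of instructions.  A rightward sweep loads [o1] into [SX] and
   executes it; a leftward sweep executes it again and rotates the list. *)
Inductive slot_letter := SD of instr | SI of instr | SX of instr & bool | SZ.
Definition slot_letter_code l := match l with
  | SD o => Some (inl (true, o)) | SI o => Some (inl (false, o))
  | SX o x => Some (inr (o, x)) | SZ => None end.
Definition slot_letter_decode l := match l with
  | Some (inl (true, o)) => SD o | Some (inl (false, o)) => SI o
  | Some (inr (o, x)) => SX o x | None => SZ end.
Lemma slot_letter_codeK : cancel slot_letter_code slot_letter_decode. Proof. by case. Qed.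
HB.instance Definition _ := Equality.copy slot_letter (can_type slot_letter_codeK).
HB.instance Definition _ := Choice.copy slot_letter (can_type slot_letter_codeK).
HB.instance Definition _ := Countable.copy slot_letter (can_type slot_letter_codeK).
HB.instance Definition _ := Finite.copy slot_letter (can_type slot_letter_codeK).

(** [Run] carries an instruction in transit and the carry bit. [Acc] completes the rightward sweep,
    erases the row on the way back and becomes [Er] at the left end. *)
Inductive pstate := Run of instr & bool | Acc | Er.
Definition pstate_code p := match p with
  | Run o c => inl (o, c) | Acc => inr true | Er => inr false end.
Definition pstate_decode p := match p with
  | inl (o, c) => Run o c | inr true => Acc | inr false => Er end.
Lemma pstate_codeK : cancel pstate_code pstate_decode. Proof. by case. Qed.
HB.instance Definition _ := Equality.copy pstate (can_type pstate_codeK).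
HB.instance Definition _ := Choice.copy pstate (can_type pstate_codeK).
HB.instance Definition _ := Countable.copy pstate (can_type pstate_codeK).
HB.instance Definition _ := Finite.copy pstate (can_type pstate_codeK).

Definition pdr (p : pstate) (a : slot_letter) : slot_letter * pstate := match p, a with
  | Run _ c, SD o => (a, Run o c)
  | Run o c, SX _ x => if o.1 (c, x) is Some (c', x') then (SX o x', Run o c') else (SX o x, Acc)
  | Er, _ => (SZ, Er)
  | _, _ => (a, p) end.
(** The rotation: [SX] gives up the executed instruction, each [SI] exchanges its own for the one in
    transit, and [SD] takes what arrives. Its old content may be lost, being the one executed, which
    has gone to the end of the list. *)
Definition pdl (p : pstate) (a : slot_letter) : slot_letter * pstate := match p, a with
  | Run _ c, SX o x => (SX nop (o.2 (c, x)).2, Run o (o.2 (c, x)).1)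
  | Run h c, SI o => (SI h, Run o c)
  | Run h c, SD o => (SD h, p)
  | Run _ _, SZ => (a, p)
  | _, _ => (SZ, p) end.
Definition ptl (p : pstate) : pstate := match p with Run _ c => Run nop c | _ => Er end.

Definition pshuttle := shuttle pdr pdl id ptl Er.

Lemma pdr_Er p a : p != Er -> (pdr p a).2 != Er.
Proof. by case: p => // o c; case: a => //= o' x; case: (o.1 _) => [[]|]. Qed.

Lemma pshuttle_Er n c : c.1 = Er -> iter n pshuttle c = c.
Proof. by move=> e; elim: n => //= n ->; rewrite /pshuttle /shuttle e. Qed.

(** * Cyclic programs acting on rows of bits *)

Section Program.
Variable C : Type.

(* Bits are addressed by [C]; the machine accepts as soon as a rightward sweep
   meets, at some [k], a bit [x] such that [rstop k x]. *)
Record round := Round {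
  rstop : C -> bool -> bool;
  rright : C -> bool -> bool -> bool * bool;
  rleft : C -> bool -> bool -> bool * bool }.

Definition instr_at (k : C) (r : round) : instr :=
  ([ffun p => if rstop r k p.2 then None else Some (rright r k p.1 p.2)],
   [ffun p => rleft r k p.1 p.2]).

Definition slot (prog : seq round) (t : C * bool) : seq slot_letter :=
  if map (instr_at t.1) prog is o :: os then SD o :: rcons (map SI os) (SX nop t.2) else [::].

Definition slots prog (s : seq (C * bool)) := flatten (map (slot prog) s).

Fixpoint scan (f : C -> bool -> bool -> bool * bool) c (s : seq (C * bool)) : bool * seq (C * bool) :=
  if s is (k, x) :: s' then
    let: (c', s'') := scan f (f k c x).1 s' in (c', (k, (f k c x).2) :: s'')
  else (c, [::]).

Definition exec (cs : bool * seq (C * bool)) (r : round) : bool * seq (C * bool) :=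
  let: (c, s) := scan (rright r) cs.1 cs.2 in
  let: (c', s') := scan (rleft r) c (rev s) in (c', rev s').

Lemma scan_cat f c s s' : scan f c (s ++ s') =
  ((scan f (scan f c s).1 s').1, (scan f c s).2 ++ (scan f (scan f c s).1 s').2).
Proof.
elim: s c => [|[k x] s IH] c /=; first by case: scan.
by rewrite IH; case: (scan f _ s) => [c' s''] /=.
Qed.

(** A slot between the two sweeps of a round, when both [SD] and [SX] hold the current
    instruction. *)
Definition loaded r prog (t : C * bool) : seq slot_letter :=
  SD (instr_at t.1 r) :: rcons (map SI (map (instr_at t.1) prog)) (SX (instr_at t.1 r) t.2).

Lemma smealy_SI_r o c l : smealy pdr (Run o c) (map SI l) = (Run o c, map SI l).
Proof. by elim: l => //= a l ->. Qed.

Lemma slots_cons prog t s : slots prog (t :: s) = slot prog t ++ slots prog s.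
Proof. by []. Qed.

Lemma smealy_slot_r r prog h c t : smealy pdr (Run h c) (slot (r :: prog) t) =
  if rstop r t.1 t.2 then (Acc, loaded r prog t) else
  (Run (instr_at t.1 r) (rright r t.1 c t.2).1, loaded r prog (t.1, (rright r t.1 c t.2).2)).
Proof.
rewrite /slot /loaded /= -!cats1 smealy_cat smealy_SI_r /= ffunE /=.
by case: ifP => //=; case: (rright _ _ _ _).
Qed.

Lemma pdr_slots r prog h c s : ~~ has (fun t => rstop r t.1 t.2) s ->
  exists h', smealy pdr (Run h c) (slots (r :: prog) s) =
    (Run h' (scan (rright r) c s).1, flatten (map (loaded r prog) (scan (rright r) c s).2)).
Proof.
elim: s h c => [|[k x] s IH] h c; first by exists h.
rewrite [has _ _]/= negb_or => /andP[/negbTE st /(IH (instr_at k r) (rright r k c x).1)[h' E]]; exists h'.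
rewrite slots_cons smealy_cat smealy_slot_r st {}E /=.
by case: (scan _ _ s) => c' s' /=; rewrite /loaded.
Qed.

Lemma pdr_stop r prog h c s : has (fun t => rstop r t.1 t.2) s ->
  (smealy pdr (Run h c) (slots (r :: prog) s)).1 = Acc.
Proof.
have acc w : (smealy pdr Acc w).1 = Acc by elim: w.
elim: s h c => // [[k x] s] IH h c; rewrite slots_cons smealy_cat smealy_slot_r /=.
by case: ifP => //= _; apply: IH.
Qed.

Lemma smealy_SI_l h c l d : smealy pdl (Run h c) (rcons (map SI l) (SD d)) =
  (Run (last h l) c, rcons (map SI (belast h l)) (SD (last h l))).
Proof. by elim: l h => //= a l IH h; rewrite IH. Qed.

Lemma smealy_slot_l r prog h c t : exists h', smealy pdl (Run h c) (rev (loaded r prog t)) =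
  (Run h' (rleft r t.1 c t.2).1, rev (slot (rcons prog r) (t.1, (rleft r t.1 c t.2).2))).
Proof.
rewrite /loaded rev_cons rev_rcons -map_rev /= ffunE smealy_SI_l /=.
set o := instr_at t.1 r; set os := map _ prog; exists (last o (rev os)).
congr (_, _); rewrite /slot map_rcons -/o -/os.
have -> : rcons os o = rev (o :: rev os) by rewrite rev_cons revK.
rewrite [o :: rev os]lastI rev_rcons /= rev_cons rev_rcons map_rev revK.
by [].
Qed.

Lemma pdl_slots r prog h c s :
  exists h', smealy pdl (Run h c) (rev (flatten (map (loaded r prog) (rev s)))) =
    (Run h' (scan (rleft r) c s).1,
     rev (slots (rcons prog r) (rev (scan (rleft r) c s).2))).
Proof.
elim: s h c => [|[k x] s IH] h c; first by exists h.
rewrite rev_cons map_rcons flatten_rcons rev_cat smealy_cat.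
have [h1 ->] := smealy_slot_l r prog h c (k, x).
have [h' E] := IH h1 (rleft r k c x).1; exists h'; rewrite {}E /=.
by case: (scan _ _ s) => c' s' /=; rewrite rev_cons /slots map_rcons flatten_rcons rev_cat.
Qed.

Lemma pshuttle_run r prog c s : ~~ has (fun t => rstop r t.1 t.2) s ->
  pshuttle (Run nop c, slots (r :: prog) s) =
    (Run nop (exec (c, s) r).1, slots (rcons prog r) (exec (c, s) r).2).
Proof.
move=> st; rewrite /pshuttle /shuttle /= /exec /=.
have [h ->] := pdr_slots prog nop c st.
case: (scan _ c s) => c1 s1 /=.
have [h' E] := pdl_slots r prog h c1 (rev s1); move: E; rewrite !revK => ->.
by case: (scan _ c1 (rev s1)) => c2 s2 /=; rewrite revK.
Qed.

Lemma pshuttle_stop r prog c s : has (fun t => rstop r t.1 t.2) s ->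
  pshuttle (Run nop c, slots (r :: prog) s) =
    (Er, nseq (size (slots (r :: prog) s)) SZ).
Proof.
move=> st; rewrite /pshuttle /shuttle /=.
have := pdr_stop prog nop c st; have := size_smealy pdr (Run nop c) (slots (r :: prog) s).
case: (smealy pdr _ _) => p u /= <- ->.
have acc w : smealy pdl Acc w = (Acc, nseq (size w) SZ) by elim: w => //= a w ->.
by rewrite acc /= size_rev rev_nseq.
Qed.

Definition sweeps : Type := (C -> bool -> bool -> bool * bool) * (C -> bool -> bool -> bool * bool).
Definition quiet (p : sweeps) : round := Round (fun _ _ => false) p.1 p.2.

Lemma pshuttle_prog l prog c s :
  iter (size l) pshuttle (Run nop c, slots (map quiet l ++ prog) s) =
    (Run nop (foldl exec (c, s) (map quiet l)).1,
     slots (prog ++ map quiet l) (foldl exec (c, s) (map quiet l)).2).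
Proof.
elim: l prog c s => [|p l IH] prog c s; first by rewrite cats0.
rewrite [size _]/= iterSr [map _ _ ++ _]/= pshuttle_run; last by elim: s.
by rewrite rcons_cat IH -cats1 -catA /= -surjective_pairing.
Qed.

Section Blocks.
Variables (cols : seq C) (Z : Type) (bit : Z -> C -> bool).
Definition block z := [seq (k, bit z k) | k <- cols].
Definition bits zs := flatten (map block zs).

Fixpoint scanz (f : bool -> Z -> bool * Z) c zs : bool * seq Z :=
  if zs is z :: zs' then
    let: (c', zs'') := scanz f (f c z).1 zs' in (c', (f c z).2 :: zs'')
  else (c, [::]).

Lemma scanz_cat f c s s' : scanz f c (s ++ s') =
  ((scanz f (scanz f c s).1 s').1, (scanz f c s).2 ++ (scanz f (scanz f c s).1 s').2).
Proof.
elim: s c => [|z s IH] c /=; first by case: scanz.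
by rewrite IH; case: (scanz f _ s) => [c' s''] /=.
Qed.

Lemma scan_bits f g c zs :
  (forall c z, scan f c (block z) = ((g c z).1, block (g c z).2)) ->
  scan f c (bits zs) = ((scanz g c zs).1, bits (scanz g c zs).2).
Proof.
move=> E; elim: zs c => //= z zs IH c; rewrite /bits /= scan_cat E /= -/(bits zs) IH.
by case: (scanz g _ zs).
Qed.

Lemma scan_rev_bits f g c zs :
  (forall c z, scan f c (rev (block z)) = ((g c z).1, rev (block (g c z).2))) ->
  scan f c (rev (bits zs)) = ((scanz g c (rev zs)).1, rev (bits (rev (scanz g c (rev zs)).2))).
Proof.
move=> E; elim/last_ind: zs c => //= zs z IH c.
rewrite /bits map_rcons flatten_rcons rev_cat rev_rcons scan_cat E /= -/(bits zs) IH.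
case: (scanz g _ (rev zs)) => c' zs' /=.
by rewrite rev_cons map_rcons flatten_rcons rev_cat.
Qed.

Lemma exec_bits p gr gl c zs :
  (forall c z, scan p.1 c (block z) = ((gr c z).1, block (gr c z).2)) ->
  (forall c z, scan p.2 c (rev (block z)) = ((gl c z).1, rev (block (gl c z).2))) ->
  exec (c, bits zs) (quiet p) =
    ((scanz gl (scanz gr c zs).1 (rev (scanz gr c zs).2)).1,
     bits (rev (scanz gl (scanz gr c zs).1 (rev (scanz gr c zs).2)).2)).
Proof.
move=> Er El; rewrite /exec /= (scan_bits c zs Er).
by rewrite (scan_rev_bits (scanz gr c zs).1 (scanz gr c zs).2 El) revK.
Qed.
End Blocks.

Section Segments.
Variables (T : eqType) (K : T -> C) (f : C -> bool -> bool -> bool * bool) (b : T -> bool).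

Lemma scan_map (u : bool -> T -> bool -> bool) c e :
  (forall t x, f (K t) c x = (c, u c t x)) ->
  scan f c [seq (K t, b t) | t <- e] = (c, [seq (K t, u c t (b t)) | t <- e]).
Proof. by move=> E; elim: e => //= t e IH; rewrite E /= IH. Qed.

Lemma scan_id c e : (forall t x, f (K t) c x = (c, x)) ->
  scan f c [seq (K t, b t) | t <- e] = (c, [seq (K t, b t) | t <- e]).
Proof. exact: (@scan_map (fun _ _ x => x)). Qed.

Lemma scan_one t0 g c e : (forall t c x, f (K t) c x = if t == t0 then g c x else (c, x)) ->
  uniq e -> t0 \in e ->
  scan f c [seq (K t, b t) | t <- e] =
    ((g c (b t0)).1, [seq (K t, if t == t0 then (g c (b t0)).2 else b t) | t <- e]).
Proof.
move=> E; elim: e c => //= t e IH c /andP[te ue]; rewrite inE E eq_sym.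
case: eqP => [Et _|/eqP ne /= t0e]; last first.
  by rewrite IH //.
subst t0; have id' c' : scan f c' [seq (K t, b t) | t <- e] = (c', [seq (K t, b t) | t <- e]).
  elim: e te {IH ue} => //= t' e IHe; rewrite inE negb_or => /andP[tt' te].
  by rewrite E [t' == t]eq_sym (negbTE tt') /= IHe.
rewrite id' //=; congr (_, _ :: _); apply/eq_in_map => t' t'e.
by case: eqP => // Et; rewrite -Et t'e in te.
Qed.
End Segments.
End Program.
Arguments Round {C}.

(** * Steps of a Turing machine as a cyclic program *)

Section Compiler.
Variables (B : Type) (M : TM B).
Let Q := tm_state M.
Let A := tm_sym M.

(* One block per tape cell: [QC q] marks the head in state [q], [SY a] the
   symbol [a]; [NL q] and [NR q] mark a state about to move left and right, and
   [FL] is a scratch bit. *)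
Inductive col := NL of Q | QC of Q | NR of Q | SY of A | FL.
(** The order matters. Rightwards, the carry meets [QC] and then [SY] before it reaches [FL]. A
    moving state is picked up only after a carry from the previous cell has been absorbed at [QC]:
    leftward sweeps meet [NL] after [QC], and rightward sweeps meet [NR] after [QC]. *)
Definition cols : seq col :=
  map NL (enum Q) ++ map QC (enum Q) ++ map NR (enum Q) ++ map SY (enum A) ++ [:: FL].

Definition cell : Type := ({set Q} * {set Q} * {set Q} * A * bool)%type.
Definition cbit (z : cell) (k : col) : bool :=
  let: (tl, tq, tr, a, f) := z in
  match k with NL q => q \in tl | QC q => q \in tq | NR q => q \in tr
  | SY a' => a' == a | FL => f end.

(** An instruction sees only one bit at a time, so the carry forms the conjunction of the bits
    [QC q] and [SY a] and leaves it in [FL]. On the way back [FL] is met first and tells the rest of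
    the cell whether to change. *)
Definition fire (q : Q) (a : A) : sweeps col :=
  let: (q', b, mv) := tm_delta M q a in
  (fun k c x => match k with
     | QC q1 => if q1 == q then (x, x) else (c, x)
     | SY a1 => if a1 == a then (c && x, x) else (c, x)
     | FL => (false, c)
     | _ => (c, x) end,
   fun k c x => match k with
     | NL q1 => (c, x || [&& c, ~~ mv & q1 == q'])
     | QC q1 => (c, x && ~~ (c && (q1 == q)))
     | NR q1 => (c, x || [&& c, mv & q1 == q'])
     | SY a1 => (c, if c then a1 == b else x)
     | FL => (x, false) end).
(** The rightward sweep serves to clear the carry, on which the earlier rounds give no guarantee. *)
Definition move_left (q : Q) : sweeps col :=
  (fun k c x => if k is FL then (false, x) else (c, x),
   fun k c x => match k with
     | QC q1 => if q1 == q then (false, x || c) else (c, x)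
     | NL q1 => if q1 == q then (x, false) else (c, x)
     | _ => (c, x) end).
(* The rightward sweep also brings back a state which [move_left] has carried
   over the left end of the tape. *)
Definition move_right (q : Q) : sweeps col :=
  (fun k c x => match k with
     | QC q1 => if q1 == q then (false, x || c) else (c, x)
     | NR q1 => if q1 == q then (x, false) else (c, x)
     | _ => (c, x) end,
   fun k c x => if k is FL then (false, x) else (c, x)).
Definition check_accept : round col := Round
  (fun k x => if k is QC q then [&& tm_halting M q, tm_accepting M q & x] else false)
  (fun _ c x => (c, x)) (fun _ c x => (c, x)).

(** A fired transition leaves its state under [NL] or [NR], where later [fire] rounds do not see it,
    so a pass through the list performs a single step. Halting states have no [fire] round: a halted
    configuration is reproduced unchanged. *)
Definition step_sweeps : seq (sweeps col) :=
  [seq fire p.1 p.2 | p <- enum {: Q * A} & ~~ tm_halting M p.1] ++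
  flatten [seq [:: move_left q; move_right q] | q <- enum Q].
Definition tm_prog : seq (round col) := check_accept :: map (@quiet col) step_sweeps.

Definition fire_r (q : Q) (a : A) (c : bool) (z : cell) : bool * cell :=
  let: (tl, tq, tr, a1, f) := z in (false, (tl, tq, tr, a1, (q \in tq) && (a == a1))).
Definition fire_l (q : Q) (a : A) (c : bool) (z : cell) : bool * cell :=
  let: (tl, tq, tr, a1, f) := z in let: (q', b, mv) := tm_delta M q a in
  (f, if f then ((if mv then tl else q' |: tl), tq :\ q, (if mv then q' |: tr else tr), b, false)
      else (tl, tq, tr, a1, false)).

Lemma scan_cols f c z :
  scan f c (block cols cbit z) =
  let: (c1, s1) := scan f c [seq (NL q, cbit z (NL q)) | q <- enum Q] in
  let: (c2, s2) := scan f c1 [seq (QC q, cbit z (QC q)) | q <- enum Q] in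
  let: (c3, s3) := scan f c2 [seq (NR q, cbit z (NR q)) | q <- enum Q] in
  let: (c4, s4) := scan f c3 [seq (SY a, cbit z (SY a)) | a <- enum A] in
  ((f FL c4 (cbit z FL)).1, s1 ++ s2 ++ s3 ++ s4 ++ [:: (FL, (f FL c4 (cbit z FL)).2)]).
Proof.
rewrite /block /cols; move: (enum Q) (enum A) => eQ eA.
rewrite !map_cat -!map_comp /= !scan_cat /=.
case: (scan f c _) => c1 s1 /=; case: (scan f c1 _) => c2 s2 /=.
by case: (scan f c2 _) => c3 s3 /=; case: (scan f c3 _).
Qed.

Lemma scan_rev_cols f c z :
  scan f c (rev (block cols cbit z)) =
  let: (c0, x0) := f FL c (cbit z FL) in
  let: (c4, s4) := scan f c0 [seq (SY a, cbit z (SY a)) | a <- rev (enum A)] in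
  let: (c3, s3) := scan f c4 [seq (NR q, cbit z (NR q)) | q <- rev (enum Q)] in
  let: (c2, s2) := scan f c3 [seq (QC q, cbit z (QC q)) | q <- rev (enum Q)] in
  let: (c1, s1) := scan f c2 [seq (NL q, cbit z (NL q)) | q <- rev (enum Q)] in
  (c1, (FL, x0) :: s4 ++ s3 ++ s2 ++ s1).
Proof.
rewrite /block /cols; move: (enum Q) (enum A) => eQ eA.
rewrite !map_cat -!map_comp !rev_cat -!map_rev /=.
rewrite -!catA /= !scan_cat /=; case: (f FL _ _) => c0 x0 /=.
case: (scan f c0 _) => c1 s1 /=; case: (scan f c1 _) => c2 s2 /=.
by case: (scan f c2 _) => c3 s3 /=; case: (scan f c3 _).
Qed.

Lemma block_cols (s1 s2 s3 : Q -> bool) s4 x z :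
  (forall q, s1 q = cbit z (NL q)) -> (forall q, s2 q = cbit z (QC q)) ->
  (forall q, s3 q = cbit z (NR q)) -> (forall a, s4 a = cbit z (SY a)) -> x = cbit z FL ->
  [seq (NL q, s1 q) | q <- enum Q] ++ [seq (QC q, s2 q) | q <- enum Q] ++
  [seq (NR q, s3 q) | q <- enum Q] ++ [seq (SY a, s4 a) | a <- enum A] ++ [:: (FL, x)] =
  block cols cbit z.
Proof.
move=> E1 E2 E3 E4 ->; rewrite /block /cols !map_cat -!map_comp /=.
by congr (_ ++ (_ ++ (_ ++ (_ ++ _)))); apply: eq_map => ? /=; rewrite ?E1 ?E2 ?E3 ?E4.
Qed.

Lemma rev_block_cols (s1 s2 s3 : Q -> bool) s4 x z :
  (forall q, s1 q = cbit z (NL q)) -> (forall q, s2 q = cbit z (QC q)) ->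
  (forall q, s3 q = cbit z (NR q)) -> (forall a, s4 a = cbit z (SY a)) -> x = cbit z FL ->
  (FL, x) :: [seq (SY a, s4 a) | a <- rev (enum A)] ++ [seq (NR q, s3 q) | q <- rev (enum Q)] ++
  [seq (QC q, s2 q) | q <- rev (enum Q)] ++ [seq (NL q, s1 q) | q <- rev (enum Q)] =
  rev (block cols cbit z).
Proof.
move=> E1 E2 E3 E4 E5; rewrite -(block_cols E1 E2 E3 E4 E5) !rev_cat -!map_rev /=.
by rewrite -!catA.
Qed.

Let enumP (T : finType) (t : T) : uniq (enum T) /\ t \in enum T.
Proof. by rewrite enum_uniq mem_enum. Qed.
Let renumP (T : finType) (t : T) : uniq (rev (enum T)) /\ t \in rev (enum T).
Proof. by rewrite rev_uniq mem_rev; apply: enumP. Qed.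

Lemma fire_rP q a c z : scan (fire q a).1 c (block cols cbit z) =
  ((fire_r q a c z).1, block cols cbit (fire_r q a c z).2).
Proof.
rewrite scan_cols /fire; case: (tm_delta M q a) => [[q' b] mv] /=.
rewrite scan_id // (@scan_one _ Q QC _ _ q (fun _ x => (x, x))) //; try by case: (enumP q).
rewrite scan_id // (@scan_one _ A SY _ _ a (fun c x => (c && x, x))) //; try by case: (enumP a).
case: z => [[[[tl tq] tr] a1] f] /=; congr pair; apply: block_cols => //= t; by case: eqP => // ->.
Qed.
Lemma fire_lP q a c z : scan (fire q a).2 c (rev (block cols cbit z)) =
  ((fire_l q a c z).1, rev (block cols cbit (fire_l q a c z).2)).
Proof.
rewrite scan_rev_cols /fire /fire_l; case: z => [[[[tl tq] tr] a1] f] /=.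
case: (tm_delta M q a) => [[q' b] mv] /=.
rewrite (@scan_map _ _ SY _ _ (fun c a2 x => if c then a2 == b else x)) //.
rewrite (@scan_map _ _ NR _ _ (fun c q1 x => x || [&& c, mv & q1 == q'])) //.
rewrite (@scan_map _ _ QC _ _ (fun c q1 x => x && ~~ (c && (q1 == q)))) //.
rewrite (@scan_map _ _ NL _ _ (fun c q1 x => x || [&& c, ~~ mv & q1 == q'])) //.
case: f; case: mv => /=; congr pair; apply: rev_block_cols => //= t; rewrite ?inE ?orbF ?andbT //;
  by rewrite 1?[RHS]orbC // andbC.
Qed.

Definition unloaded (c : bool) (z : cell) : bool * cell := (false, z).
Definition move_left_l (q : Q) (c : bool) (z : cell) : bool * cell :=
  let: (tl, tq, tr, a, f) := z in
  (q \in tl, (tl :\ q, (if c then q |: tq else tq), tr, a, f)).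
Definition move_right_r (q : Q) (c : bool) (z : cell) : bool * cell :=
  let: (tl, tq, tr, a, f) := z in
  (q \in tr, (tl, (if c then q |: tq else tq), tr :\ q, a, f)).

Lemma move_left_rP q c z : scan (move_left q).1 c (block cols cbit z) =
  ((unloaded c z).1, block cols cbit (unloaded c z).2).
Proof.
rewrite scan_cols; case: z => [[[[tl tq] tr] a1] f] /=.
by rewrite !scan_id //=; congr pair; apply: block_cols.
Qed.

Lemma move_right_lP q c z : scan (move_right q).2 c (rev (block cols cbit z)) =
  ((unloaded c z).1, rev (block cols cbit (unloaded c z).2)).
Proof.
rewrite scan_rev_cols; case: z => [[[[tl tq] tr] a1] f] /=.
by rewrite !scan_id //=; congr pair; apply: rev_block_cols.
Qed.

Lemma move_left_lP q c z : scan (move_left q).2 c (rev (block cols cbit z)) =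
  ((move_left_l q c z).1, rev (block cols cbit (move_left_l q c z).2)).
Proof.
rewrite scan_rev_cols; case: z => [[[[tl tq] tr] a1] f] /=.
rewrite (@scan_id _ _ SY) // (@scan_id _ _ NR) //.
rewrite (@scan_one _ Q QC _ _ q (fun c x => (false, x || c))) //=; try by case: (renumP q).
rewrite (@scan_one _ Q NL _ _ q (fun _ x => (x, false))) //=; try by case: (renumP q).
congr pair; apply: rev_block_cols => //= t; rewrite ?inE; first by case: eqP.
by case: c; rewrite ?inE ?orbT ?orbF; case: eqP => // ->.
Qed.

Lemma move_right_rP q c z : scan (move_right q).1 c (block cols cbit z) =
  ((move_right_r q c z).1, block cols cbit (move_right_r q c z).2).
Proof.
rewrite scan_cols; case: z => [[[[tl tq] tr] a1] f] /=.
rewrite scan_id //= (@scan_one _ Q QC _ _ q (fun c x => (false, x || c))) //=; try by case: (enumP q).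
rewrite (@scan_one _ Q NR _ _ q (fun _ x => (x, false))) //=; try by case: (enumP q).
rewrite scan_id //=.
congr pair; apply: block_cols => //= t; rewrite ?inE; last by case: eqP.
by case: c; rewrite ?inE ?orbT ?orbF; case: eqP => // ->.
Qed.

Definition plain (a : A) : cell := (set0, set0, set0, a, false).
Definition headed (q : Q) (a : A) : cell := (set0, [set q], set0, a, false).
Definition moving (mv : bool) (q : Q) (a : A) : cell :=
  (if mv then set0 else [set q], set0, if mv then [set q] else set0, a, false).
Definition tape (l : seq A) (z : cell) (r : seq A) : seq cell :=
  map plain (rev l) ++ z :: map plain r.
Let tbits l z r := bits cols cbit (tape l z r).

Lemma rev_tape l z r : rev (tape l z r) = map plain (rev r) ++ z :: map plain l.
Proof. by rewrite /tape rev_cat rev_cons -!map_rev revK cat_rcons. Qed.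

Lemma scanz_plain f c u : (forall a, f c (plain a) = (c, plain a)) ->
  scanz f c (map plain u) = (c, map plain u).
Proof. by move=> E; elim: u => //= a u IH; rewrite E /= IH. Qed.

Lemma scanz_unloaded c z zs : scanz unloaded c (z :: zs) = (false, z :: zs).
Proof. by rewrite /=; elim: zs => //= z' zs; case: (scanz _ _ zs) => c' s [-> ->]. Qed.

Lemma scanz_map (f : bool -> cell -> bool * cell) g c zs : (forall c z, (f c z).2 = g z) -> (scanz f c zs).2 = map g zs.
Proof.
by move=> E; elim: zs c => //= z zs IH c; rewrite -(E c) -(IH (f c z).1); case: (scanz _ _ zs).
Qed.

Definition fire_cell q a (z : cell) : cell := (fire_l q a false (fire_r q a false z).2).2.

Lemma exec_fire q a c zs : exists c',
  exec (c, bits cols cbit zs) (quiet (fire q a)) = (c', bits cols cbit (map (fire_cell q a) zs)).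
Proof.
rewrite (exec_bits c zs (fire_rP q a) (fire_lP q a)); eexists; congr (_, bits _ _ _).
rewrite (scanz_map (g := fun z : cell => (fire_l q a false z).2)).
  rewrite (scanz_map (g := fun z : cell => (fire_r q a false z).2)).
    by rewrite -map_rev revK -map_comp.
  by move=> c' [[[[? ?] ?] ?] ?].
by move=> c' [[[[? ?] ?] ?] ?] /=; case: (tm_delta M q a) => [[? ?] ?].
Qed.

Lemma fire_plain q a b : fire_cell q a (plain b) = plain b.
Proof. by rewrite /fire_cell /= inE /=; case: (tm_delta M q a) => [[? ?] ?]. Qed.

Lemma fire_moving q a mv q' b : fire_cell q a (moving mv q' b) = moving mv q' b.
Proof. by rewrite /fire_cell /= inE /=; case: (tm_delta M q a) => [[? ?] ?]. Qed.

Lemma fire_headed q a q' a' : fire_cell q a (headed q' a') =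
  if (q, a) == (q', a') then moving (tm_delta M q a).2 (tm_delta M q a).1.1 (tm_delta M q a).1.2
  else headed q' a'.
Proof.
rewrite /fire_cell /= inE xpair_eqE; case: (tm_delta M q a) => [[q1 b1] mv].
case: andP => // -[/eqP-> _]; rewrite /moving setDv !setU0; by case: mv.
Qed.

Lemma exec_fire_tape q a c l z r : exists c',
  exec (c, tbits l z r) (quiet (fire q a)) = (c', tbits l (fire_cell q a z) r).
Proof.
have [c' ->] := exec_fire q a c (tape l z r); exists c'; congr (_, bits _ _ _).
by rewrite /tape map_cat /= -!map_comp; congr (_ ++ _ :: _); apply: eq_map => b; apply: fire_plain.
Qed.

Lemma tape_cons l z r : exists z' zs, tape l z r = z' :: zs.
Proof. by rewrite /tape; case: (rev l) => [|b v]; do 2!eexists. Qed.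

Lemma exec_move_left q c l z r : exec (c, tbits l z r) (quiet (move_left q)) =
  let: (c', zs) := scanz (move_left_l q) false (z :: map plain l) in
  (c', bits cols cbit (rev zs ++ map plain r)).
Proof.
rewrite (exec_bits c _ (move_left_rP q) (move_left_lP q)).
have [z' [zs E]] := tape_cons l z r.
rewrite E scanz_unloaded -E rev_tape scanz_cat scanz_plain; last first.
  by move=> b; rewrite /move_left_l /plain inE set0D.
by case: (scanz _ _ (z :: _)) => c' zs' /=; rewrite rev_cat -map_rev revK.
Qed.

Lemma exec_move_right q c l z r :
  exec (c, tbits l z r) (quiet (move_right q)) =
  (false, bits cols cbit (scanz (move_right_r q) c (tape l z r)).2).
Proof.
rewrite (exec_bits c _ (move_right_rP q) (move_right_lP q)).
have ne : (scanz (move_right_r q) c (tape l z r)).2 != [::].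
  by have [z' [zs ->]] := tape_cons l z r; rewrite /=; case: (scanz _ _ zs).
case: (scanz _ _ _) ne => c' zs' /= ne.
have : rev zs' != [::] by apply: contraNneq ne => e; rewrite -(revK zs') e.
by case E: (rev zs') => [|z1 zs1] // _; rewrite scanz_unloaded /= -E revK.
Qed.

Lemma move_left_plain q b : move_left_l q false (plain b) = (false, plain b).
Proof. by rewrite /move_left_l /plain inE set0D. Qed.
Lemma move_right_plain q b : move_right_r q false (plain b) = (false, plain b).
Proof. by rewrite /move_right_r /plain inE set0D. Qed.

Lemma exec_move_left_id q c l z r : move_left_l q false z = (false, z) ->
  exec (c, tbits l z r) (quiet (move_left q)) = (false, tbits l z r).
Proof.
move=> E; rewrite exec_move_left /= E /= (scanz_plain l (move_left_plain q)).
by rewrite rev_cons -map_rev cat_rcons.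
Qed.

Lemma exec_move_right_id q l z r : move_right_r q false z = (false, z) ->
  exec (false, tbits l z r) (quiet (move_right q)) = (false, tbits l z r).
Proof.
move=> E; rewrite exec_move_right /tbits /tape scanz_cat (scanz_plain _ (move_right_plain q)) /= E /=.
by rewrite (scanz_plain r (move_right_plain q)).
Qed.

(** As in [tm_step], a left move on the first cell stays there. A right move needs a further cell in
    the row; [[::]] is a dummy value. *)
Definition moved (mv : bool) q a l (r : seq A) : seq (col * bool) :=
  if mv then (if r is y :: r' then tbits (a :: l) (headed q y) r' else [::])
  else if l is y :: l' then tbits l' (headed q y) (a :: r) else tbits [::] (headed q a) r.

Lemma exec_moves q (mv : bool) c l a (r : seq A) : (mv -> r != [::]) ->
  foldl (@exec col) (c, tbits l (moving mv q a) r) [:: quiet (move_left q); quiet (move_right q)] =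
  (false, moved mv q a l r).
Proof.
case: mv => /= hr.
  rewrite exec_move_left_id; last by rewrite /move_left_l /moving /= inE set0D.
  case: r hr => [/(_ isT) //|y r] _.
  rewrite exec_move_right /tape scanz_cat (scanz_plain _ (move_right_plain q)) /=.
  rewrite inE eqxx setDv setU0 inE set0D (scanz_plain r (move_right_plain q)) /=.
  by rewrite /tbits /tape rev_cons map_rcons cat_rcons.
rewrite exec_move_left /= inE eqxx setDv.
case: l => [|y l].
  rewrite [X in exec X _](_ : _ = (true, tbits [::] (plain a) r)) // exec_move_right.
  rewrite [tape _ _ _]/= [scanz _ _ _]/= inE setU0 set0D.
  by rewrite (scanz_plain r (move_right_plain q)).
rewrite [X in exec X _](_ : _ = (false, tbits l (headed q y) (a :: r))).
  by rewrite exec_move_right_id // /= inE set0D.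
rewrite -[(set0, _, _, _, _)]/(plain a) [scanz _ _ _]/= inE setU0 set0D (scanz_plain l (move_left_plain q)) /=.
by rewrite !rev_cons -map_rev !cat_rcons.
Qed.
Let fires lst := [seq quiet (fire p.1 p.2) | p <- lst].
Let moves lst := map (@quiet col) (flatten [seq [:: move_left q; move_right q] | q <- lst]).

Lemma exec_fires lst c l z r : (forall q a, fire_cell q a z = z) ->
  exists c', foldl (@exec col) (c, tbits l z r) (fires lst) = (c', tbits l z r).
Proof.
move=> E; elim: lst c => [|[q a] lst IH] c; first by exists c.
have [c1 E1] := exec_fire_tape q a c l z r; have [c' E'] := IH c1.
by exists c'; rewrite /= E1 E E'.
Qed.

Lemma exec_fires_headed lst q a c l r :
  exists c', foldl (@exec col) (c, tbits l (headed q a) r) (fires lst) =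
    (c', tbits l (if (q, a) \in lst then fire_cell q a (headed q a) else headed q a) r).
Proof.
elim: lst c => [|[q1 a1] lst IH] c; first by exists c.
have [c1 E1] := exec_fire_tape q1 a1 c l (headed q a) r.
rewrite [fires _]/= [foldl _ _ _]/= E1 inE eq_sym fire_headed.
case: eqP => [[-> ->]|_]; last exact: IH.
by rewrite fire_headed eqxx; apply: exec_fires => q2 a2; apply: fire_moving.
Qed.

Lemma exec_moves_id lst z l r :
  (forall q, q \in lst -> move_left_l q false z = (false, z) /\ move_right_r q false z = (false, z)) ->
  forall c, exists c', foldl (@exec col) (c, tbits l z r) (moves lst) = (c', tbits l z r).
Proof.
move=> E c; elim: lst c E => [|q lst IH] c E; first by exists c.
have [E1 E2] := E q (mem_head _ _).
rewrite [moves _]/= [foldl _ _ _]/= exec_move_left_id // exec_move_right_id //.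
have [|c' E'] := IH false; last by exists c'.
by move=> q' q'l; apply: E; rewrite inE q'l orbT.
Qed.

Lemma exec_moves_moving lst q (mv : bool) c l a r : (mv -> r != [::]) -> uniq lst -> q \in lst ->
  exists c', foldl (@exec col) (c, tbits l (moving mv q a) r) (moves lst) = (c', moved mv q a l r).
Proof.
move=> hr; elim: lst c => // q1 lst IH c /= /andP[q1l ul]; rewrite inE.
rewrite -/(moves lst) -[foldl _ _ _]/(foldl (@exec col) (foldl (@exec col) (c, tbits l (moving mv q a) r)
  [:: quiet (move_left q1); quiet (move_right q1)]) (moves lst)).
case: eqP => [<- _|/eqP ne /= ql].
  rewrite exec_moves //.
  have [l2 [a2 [r2 ->]]] : exists l2 a2 r2, moved mv q a l r = tbits l2 (headed q a2) r2.
    rewrite /moved; case: (mv) hr {IH} => [|_]; last by case: l => [|y l]; do 3!eexists.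
    by case: r => [/(_ isT)|y r _] //; do 3!eexists.
  by apply: exec_moves_id => q' _; rewrite /= inE set0D.
have [E1 E2] : move_left_l q1 false (moving mv q a) = (false, moving mv q a) /\
    move_right_r q1 false (moving mv q a) = (false, moving mv q a).
  have D : [set q] :\ q1 = [set q] by apply/setP => x; rewrite !inE; case: eqP => // ->; rewrite eq_sym (negbTE ne).
  by rewrite /moving /=; case: (mv); rewrite ?inE ?set0D ?D ?[q1 == q]eq_sym ?(negbTE ne).
by rewrite /= exec_move_left_id // exec_move_right_id //; apply: IH.
Qed.

(** The row cannot grow, so within the space bound all [N] cells are present from the start, those
    not yet touched being blank. *)
Definition config_bits N (c : config M) : seq (col * bool) :=
  let: (q, l, a, r) := c in tbits l (headed q a) (r ++ nseq (N - tm_space c) (tm_blank M)).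

Lemma exec_check cs : exec cs check_accept = cs.
Proof.
have id (s : seq (col * bool)) c : scan (fun _ c x => (c, x)) c s = (c, s).
  by elim: s c => //= [[k x] s] IH c; rewrite IH.
by case: cs => c s; rewrite /exec /= !id revK.
Qed.

Lemma exec_tm_prog N cc (c : config M) : tm_space (tm_step c) <= N ->
  exists c', foldl (@exec col) (cc, config_bits N c) tm_prog = (c', config_bits N (tm_step c)).
Proof.
case: c => [[[q l] a] r]; rewrite [foldl _ _ _]/= exec_check /step_sweeps map_cat foldl_cat.
rewrite -map_comp -[map (_ \o _) _]/(fires _) -/(moves _).
set lst := [seq _ <- _ | _].
have lstE : (q, a) \in lst = ~~ tm_halting M q by rewrite mem_filter mem_enum andbT.
have [c1 ->] := exec_fires_headed lst q a cc l (r ++ nseq (N - tm_space (q, l, a, r)) (tm_blank M)).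
rewrite lstE {lst lstE} /tm_step; case: ifP => hq /=.
  by move=> sp; apply: exec_moves_id => q' _; rewrite /= inE set0D.
rewrite -[fire_cell _ _ _]/(fire_cell q a (headed q a)) fire_headed eqxx.
case: (tm_delta M q a) => [[q' b] mv] /= sp.
have [||c2 ->] := @exec_moves_moving (enum Q) q' mv c1 l b
  (r ++ nseq (N - (size l + 1 + size r)) (tm_blank M)) _ (enum_uniq Q).
(* A right move beyond the touched cells increases the space, so the bound [sp] leaves a blank cell
   to move to. *)
- by case: mv sp => //; case: r => //= sp _; case E: (N - _) => //; lia.
- by rewrite mem_enum.
exists c2; congr pair; case: mv sp => /=.
  case: r => [|y r] /= sp.
    have -> : N - (size l + 1 + 0) = (N - ((size l).+1 + 1 + 0)).+1 by lia.
    by [].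
  by congr (tbits _ _ (_ ++ nseq _ _)); lia.
by case: l => [|y l] /= sp; [congr (tbits _ _ (_ ++ nseq _ _))|congr (tbits _ _ (_ :: _ ++ nseq _ _))]; lia.
Qed.

Definition accepts (c : config M) := tm_halting M (cstate c) && tm_accepting M (cstate c).

Lemma has_stop_block z : has (fun t => rstop check_accept t.1 t.2) (block cols cbit z) =
  has (fun q => [&& tm_halting M q, tm_accepting M q & q \in z.1.1.1.2]) (enum Q).
Proof.
case: z => [[[[tl tq] tr] a] f].
rewrite /block /cols; move: (enum Q) (enum A) => eQ eA; rewrite has_map !has_cat !has_map.
transitivity (false || (has (fun q => [&& tm_halting M q, tm_accepting M q & q \in tq]) eQ || false)).
  by congr (_ || (_ || _)); [elim: eQ|elim: (eQ) => //; elim: (eA)].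
by rewrite /= orbF.
Qed.

Lemma has_stop N (c : config M) :
  has (fun t => rstop check_accept t.1 t.2) (config_bits N c) = accepts c.
Proof.
have plainN v : has (fun t => rstop check_accept t.1 t.2) (bits cols cbit (map plain v)) = false.
  elim: v => //= b v IH; rewrite /bits /= has_cat -/(bits _ _ _) IH orbF has_stop_block.
  by apply/negbTE/hasPn => q _; rewrite inE !andbF.
case: c => [[[q l] a] r]; rewrite /config_bits /tbits /tape /bits map_cat flatten_cat has_cat /= has_cat.
rewrite -!/(bits _ _ _) !plainN orbF /= has_stop_block /accepts /cstate /=.
apply/hasP/andP => [[q1 _]|[h1 h2]]; first by rewrite inE => /and3P[h1 h2 /eqP <-].
by exists q; rewrite ?mem_enum // h1 h2 inE eqxx.
Qed.

Definition prog_word N c := slots tm_prog (config_bits N c).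

(** After [size tm_prog] rounds the cyclic list is back in its original order. The carry is not,
    hence the arbitrary [cc]. *)
Lemma pshuttle_tm_step N cc (c : config M) : tm_space (tm_step c) <= N -> ~~ accepts c ->
  exists c', iter (size tm_prog) pshuttle (Run nop cc, prog_word N c) = (Run nop c', prog_word N (tm_step c)).
Proof.
move=> sp ac; have [c' E] := exec_tm_prog cc sp; exists c'.
rewrite /prog_word {1 2}/tm_prog [size _]/= iterSr pshuttle_run ?has_stop // exec_check.
move: E; rewrite [foldl _ _ _]/= exec_check => E.
by rewrite size_map -cats1 pshuttle_prog -surjective_pairing E.
Qed.

Section Accept.
Variables (N : nat) (w : seq B).
Hypothesis space : forall n, tm_space (tm_run M n w) <= N.
Let start := (Run nop false, prog_word N (tm_init M w)).

Lemma pshuttle_tm_run n : (forall i, i < n -> ~~ accepts (tm_run M i w)) ->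
  exists c', iter (n * size tm_prog) pshuttle start = (Run nop c', prog_word N (tm_run M n w)).
Proof.
elim: n => [|n IH] ac; first by exists false.
have [|c' E] := IH; first by move=> i i_n; apply: ac; lia.
have [c2 E2] := pshuttle_tm_step c' (space n.+1) (ac n (leqnn _)).
by exists c2; rewrite mulSn iterD E E2.
Qed.

Lemma pshuttle_accept n : accepts (tm_run M n w) ->
  exists m, iter m pshuttle start = (Er, nseq (size start.2) SZ).
Proof.
move=> an; have ex : exists n, accepts (tm_run M n w) by exists n.
case: (ex_minnP ex) => {an} n an mn; have [|c' E] := @pshuttle_tm_run n.
  by move=> i; apply: contraTN => /mn; rewrite -leqNgt.
have sz m : size (iter m pshuttle start).2 = size start.2.
  by elim: m => //= m <-; rewrite /pshuttle size_shuttle.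
exists (n * size tm_prog).+1; rewrite iterS E /prog_word pshuttle_stop ?has_stop //.
by rewrite -(sz (n * size tm_prog)) E.
Qed.

(** [Er] is absorbing, so if it were reached in round [m] it would persist until round
    [m * size tm_prog], where [m] steps of [M] have just been simulated. *)
Lemma pshuttle_reject : (forall n, ~~ accepts (tm_run M n w)) ->
  forall m, (iter m pshuttle start).1 != Er.
Proof.
move=> ac m; have [c' E] := pshuttle_tm_run (fun i (_ : i < m) => ac i).
apply/eqP => e; move/(congr1 fst): E.
rewrite -(@subnK m (m * size tm_prog)); last by rewrite leq_pmulr.
by rewrite iterD pshuttle_Er //= e.
Qed.
End Accept.
End Compiler.

(** * Savitch's algorithm *)

Section Odometer.
Variables (S : finType) (s0 : S).
Let K : nat := #|S|.

Definition rank (s : S) := index s (enum S).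
Definition lastS (s : S) := (rank s).+1 == K.
Definition firstS : S := nth s0 (enum S) 0.
Definition nextS (s : S) : S := nth s0 (enum S) (rank s).+1.

(** Words as numbers in base [K] with the least significant digit first, so that a sweep from the
    left can propagate the carry of [incr]. *)
Fixpoint value (w : seq S) : nat := if w is a :: w' then rank a + K * value w' else 0.
Fixpoint incr (c : bool) (w : seq S) : seq S :=
  if w is a :: w' then
    (if c then (if lastS a then firstS else nextS a) else a) :: incr (c && lastS a) w'
  else [::].

Lemma rank_lt s : rank s < K.
Proof. by rewrite /K cardE index_mem mem_enum. Qed.

Lemma rank_nth i : i < K -> rank (nth s0 (enum S) i) = i.
Proof. by move=> iS; rewrite /rank index_uniq ?enum_uniq // -cardE -/K. Qed.

Lemma incr_false w : incr false w = w.
Proof. by elim: w => //= a w ->. Qed.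

Lemma value_incr w : ~~ all lastS w -> value (incr true w) = (value w).+1.
Proof.
elim: w => //= a w IH; have a_lt := rank_lt a; rewrite /lastS.
case: eqP => [al /IH -> | /eqP al _].
  by rewrite /firstS rank_nth; [rewrite mulnS; lia|lia].
by rewrite incr_false /nextS rank_nth; lia.
Qed.

Lemma value_lt w : value w < K ^ size w.
Proof.
elim: w => //= a w IH; have a_lt := rank_lt a; rewrite expnS.
have := leq_mul (leqnn K) IH; rewrite mulnS; lia.
Qed.

Lemma value_last w : all lastS w -> (value w).+1 = K ^ size w.
Proof. by elim: w => //= a w IH /andP[/eqP al /IH E]; rewrite expnS -E mulnS; lia. Qed.

Lemma value_inj v w : size v = size w -> value v = value w -> v = w.
Proof.
elim: v w => [|a v IH] [|b w] //= [sz] E.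
have /andP[/eqP ra /eqP vw] : (rank a == rank b) && (value v == value w).
  have a_lt := rank_lt a; have b_lt := rank_lt b; have S0 : 0 < K by lia.
  have := congr1 (fun x => x %% K) E; have := congr1 (fun x => x %/ K) E.
  rewrite ![rank _ + _]addnC ![K * _]mulnC !divnMDl // !modnMDl !divn_small // !modn_small //.
  by rewrite !addn0 => -> ->; rewrite !eqxx.
congr (_ :: _); last exact: IH.
by rewrite -(nth_index s0 (mem_enum S a : a \in enum S)) -/(rank a) ra nth_index ?mem_enum.
Qed.
End Odometer.

(** * The midpoint recursion *)

Section Reachability.
Variables (S : finType) (E : rel S) (n : nat).

Definition hadj (u v : seq S) : bool :=
  [&& sorted E u, sorted E v & count (fun p : S * S => p.1 != p.2) (zip u v) <= 1].

(** [hadj] is reflexive on walks, so [rch k] amounts to at most [2 ^ k] steps. *)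
Fixpoint rch (k : nat) (u v : seq S) : bool :=
  if k is k'.+1 then [exists m : n.-tuple S, rch k' u m && rch k' m v] else hadj u v.

Let e : rel (n.-tuple S) := fun u v => hadj u v.

Lemma rch_sorted k u v : rch k u v -> sorted E u /\ sorted E v.
Proof.
elim: k u v => [|k IH] u v /=; first by case/and3P.
by case/existsP => m /andP[/IH[? _] /IH[]].
Qed.

Lemma hadj_refl u : sorted E u -> hadj u u.
Proof.
rewrite /hadj => ->; suff -> : count (fun p : S * S => p.1 != p.2) (zip u u) = 0 by [].
by elim: u => //= x u ->; rewrite eqxx.
Qed.

Lemma rch_connect k (u v : n.-tuple S) : rch k u v -> connect e u v.
Proof.
elim: k u v => [|k IH] u v /=; first by move=> h; apply: connect1.
by case/existsP => m /andP[/IH h1 /IH]; apply: connect_trans.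
Qed.

Lemma path_rch k (u : n.-tuple S) p : size p = 2 ^ k -> path e u p -> rch k u (last u p).
Proof.
elim: k u p => [|k IH] u p.
  by case: p => [|v []] //= _ /andP[].
rewrite expnS mul2n -addnn => sp; rewrite -{1}(cat_take_drop (2 ^ k) p) cat_path => /andP[h1 h2].
apply/existsP; exists (last u (take (2 ^ k) p)); apply/andP; split.
  by apply: IH h1; rewrite size_takel // sp leq_addr.
have := IH _ _ _ h2; rewrite -last_cat cat_take_drop; apply.
by rewrite size_drop sp addnK.
Qed.

(** A path without repetitions has fewer than [#|S| ^ n] steps; repeating its last word stretches it
    to exactly [2 ^ k]. *)
Lemma connect_rch k (u v : n.-tuple S) : #|S| ^ n <= 2 ^ k -> sorted E u -> connect e u v -> rch k u v.
Proof.
move=> kS su /connectP[p0 /shortenP[p pp up _] ->]; move: su; clear p0 v.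
have sp : size p < 2 ^ k.
  apply: leq_trans kS; rewrite -card_tuple; apply: leq_trans (max_card (mem (u :: p))).
  by rewrite (card_uniqP up).
move=> su; have sl : sorted E (last u p).
  by case/lastP: p pp {up sp} => [//|p v]; rewrite rcons_path last_rcons => /andP[_ /and3P[]].
have -> : last u p = last u (p ++ nseq (2 ^ k - size p) (last u p)).
  by rewrite last_cat; elim: (_ - _) => //= j <-.
apply: path_rch; first by rewrite size_cat size_nseq subnKC // ltnW.
rewrite cat_path pp /=; elim: (_ - _) {sp} => //= j IHj.
by rewrite IHj andbT; apply: hadj_refl.
Qed.

Lemma Hreach_rch k (u v : n.-tuple S) : #|S| ^ n <= 2 ^ k ->
  rch k u v <-> [/\ Hword E u, Hword E v & Hreach E u v].
Proof.
move=> kS; split=> [h|[su sv]].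
  have [su sv] := rch_sorted h; split=> //.
  case/connectP: (rch_connect h) => p + ->; elim: p u {h v sv su} => [|v p IH] u /=.
    by move=> _; apply: rt_refl.
  case/andP => /and3P[h1 h2 h3] /IH; apply: rt_trans; apply: rt_step.
  by split; rewrite ?size_tuple.
move=> h; apply: connect_rch => //.
(* Steps preserve the length, so the whole walk stays among the [n]-tuples. *)
suff [_ [v' vv' c]] : size v = n /\ exists2 v' : n.-tuple S, val v' = v & connect e u v'.
  by rewrite (_ : v = v') //; apply: val_inj.
move: (val v) h => w; move/(clos_rt_rtn1 _ _ _ _); elim=> [|w1 w2 st _ [sw [v' E' c]]].
  by rewrite size_tuple; split=> //; exists u.
case: st => [h1 h2 sz ct].
have sw2 : size w2 == n by rewrite -sz sw.
split; first exact/eqP.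
exists (Tuple sw2) => //; apply: connect_trans c (connect1 _).
by rewrite /e /hadj E' /=; apply/and3P.
Qed.
End Reachability.

(** * A sweep machine evaluating the recursion *)

Section SavitchMachine.
Variables (S : finType) (E : rel S) (s0 : S).

(* A frame [(u, v, m, d, second)] asks whether [v] can be reached from [u] in at
   most [2 ^ d] steps, is trying the midpoint [m], and [second] tells which half
   is being examined.  It is stored letterwise; the unary counter [d] is the sum
   of its entries.  The whole stack is stored by columns, each column being a
   [Bar] followed by one entry of each frame, topmost frame first. *)
Definition entry : finType := (S * S * S * 'I_#|S|.+1 * bool)%type.
Definition eu (f : entry) := f.1.1.1.1.
Definition ev (f : entry) := f.1.1.1.2.
Definition em (f : entry) := f.1.1.2.
Definition ed (f : entry) : nat := f.1.2.
Definition es (f : entry) := f.2.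

Definition sletter : finType := (option S + option entry)%type.
Definition In (x : option S) : sletter := inl x.
Definition Bar : sletter := inr None.
Definition Fr (f : entry) : sletter := inr (Some f).

(* Phases acting on the topmost frame, with their Mealy states.  The argument of
   [MPush] selects the next midpoint: the first one, the current one (examining
   the second half), or the successor of the current one. *)
Inductive mstate :=
  | MCall (zero : bool) (prev : option (S * S)) (valid diff : bool)
  | MPush (kind : option bool) (cm cd : bool)
  | MPop (b : bool)
  | MRet (b seen second maximal : bool).

(** The input is turned into columns by sweeps each of which removes the first remaining letters of
    the two words and appends their pair. [Tail] and [Ready] check that both words are exhausted
    together; if there are no columns then, the words are empty and the answer is [true]. *)
Inductive sstate :=
  | Start | SeekSep of S | SeekMate of S | Paired of S & S | Tail | Ready | Fail
  | Done of bool | Main of mstate & bool.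

Definition mcode m := match m with
  | MCall z p v d => inl (inl (z, p, v, d)) | MPush k a b => inl (inr (k, a, b))
  | MPop b => inr (inl b) | MRet b s t m => inr (inr (b, s, t, m)) end.
Definition mdecode m := match m with
  | inl (inl (z, p, v, d)) => MCall z p v d | inl (inr (k, a, b)) => MPush k a b
  | inr (inl b) => MPop b | inr (inr (b, s, t, m)) => MRet b s t m end.
Lemma mcodeK : cancel mcode mdecode. Proof. by case. Qed.
HB.instance Definition _ := Equality.copy mstate (can_type mcodeK).
HB.instance Definition _ := Choice.copy mstate (can_type mcodeK).
HB.instance Definition _ := Countable.copy mstate (can_type mcodeK).
HB.instance Definition _ := Finite.copy mstate (can_type mcodeK).

Definition scode s := match s with
  | Start => inl (inl None) | SeekSep a => inl (inl (Some (true, a)))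
  | SeekMate a => inl (inl (Some (false, a))) | Paired a b => inl (inr (a, b))
  | Main m t => inr (inl (m, t))
  | Tail => inr (inr None) | Ready => inr (inr (Some None))
  | Fail => inr (inr (Some (Some None))) | Done b => inr (inr (Some (Some (Some b)))) end.
Definition sdecode s := match s with
  | inl (inl None) => Start | inl (inl (Some (true, a))) => SeekSep a
  | inl (inl (Some (false, a))) => SeekMate a | inl (inr (a, b)) => Paired a b
  | inr (inl (m, t)) => Main m t
  | inr (inr None) => Tail | inr (inr (Some None)) => Ready
  | inr (inr (Some (Some None))) => Fail | inr (inr (Some (Some (Some b)))) => Done b end.
Lemma scodeK : cancel scode sdecode. Proof. by case. Qed.
HB.instance Definition _ := Equality.copy sstate (can_type scodeK).
HB.instance Definition _ := Choice.copy sstate (can_type scodeK).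
HB.instance Definition _ := Countable.copy sstate (can_type scodeK).
HB.instance Definition _ := Finite.copy sstate (can_type scodeK).

Definition call0 := MCall true None true false.
Definition ret0 b := MRet b false false true.

Definition mid (kind : option bool) (c : bool) (m : S) : S * bool :=
  match kind with
  | None => (firstS s0, c)
  | Some true => (m, c)
  | Some false => (if c then (if lastS m then firstS s0 else nextS s0 m) else m, c && lastS m)
  end.
(** The carry passes over zero entries, so that the first positive one is decreased and the sum
    drops by one. *)
Definition dec (c : bool) (d : 'I_#|S|.+1) : 'I_#|S|.+1 * bool :=
  (if c then inord d.-1 else d, c && (d == 0 :> nat)).
(** The midpoint of the new frame is provisional: if that frame has positive depth, its own call
    resets it by [MPush None]. *)
Definition new_entry kind cm cd (f : entry) : entry :=
  let m := (mid kind cm (em f)).1 in let d := (dec cd f.1.2).1 in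
  if kind == Some true then (m, ev f, m, d, false) else (eu f, m, m, d, false).
Definition upd_entry kind cm (f : entry) : entry :=
  (eu f, ev f, (mid kind cm (em f)).1, f.1.2, kind == Some true).

(** [MCall] evaluates in one pass both the test for depth zero and [hadj]: it remembers the previous
    pair of letters to test edges, and whether the two words have already differed. *)
Definition mstep (x : mstate) (f : entry) : mstate * seq entry :=
  match x with
  | MCall z p v d =>
      (MCall (z && (ed f == 0)) (Some (eu f, ev f))
         [&& v, (if p is Some (a, b) then E a (eu f) && E b (ev f) else true) &
            ~~ (d && (eu f != ev f))]
         (d || (eu f != ev f)), [:: f])
  | MPush k cm cd =>
      (MPush k (mid k cm (em f)).2 (dec cd f.1.2).2, [:: new_entry k cm cd f; upd_entry k cm f])
  | MPop b => (MPop b, [::])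
  | MRet b _ _ m => (MRet b true (es f) (m && lastS (em f)), [:: f])
  end.

(** A result [b] is returned to the frame now on top. Success in the first half leads to the second
    half, failure in either to the next midpoint. An empty stack shows by the absence of any entry,
    and then [b] is the final answer. *)
Definition mnext (x : mstate) : sstate :=
  match x with
  | MCall z _ v _ => if z then Main (MPop v) false else Main (MPush None true true) false
  | MPush _ _ _ => Main call0 false
  | MPop b => Main (ret0 b) false
  | MRet b seen second maximal =>
      if ~~ seen then Done b
      else if b then (if second then Main (MPop true) false else Main (MPush (Some true) true true) false)
      else (if maximal then Main (MPop false) false else Main (MPush (Some false) true true) false)
  end.

Definition sdelta (q : sstate) (a : sletter) : sstate * seq sletter :=
  match q, a with
  | Start, inl (Some x) => (SeekSep x, [::])
  | Start, inl None => (Tail, [::])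
  | SeekSep x, inl (Some _) => (q, [:: a])
  | SeekSep x, inl None => (SeekMate x, [:: a])
  | SeekMate x, inl (Some y) => (Paired x y, [::])
  | Paired _ _, _ => (q, [:: a])
  | Tail, inr None => (Ready, [:: a])
  | Ready, _ => (q, [:: a])
  | Main x _, inr None => (Main x true, [:: a])
  | Main x true, inr (Some f) => (Main (mstep x f).1 false, map Fr (mstep x f).2)
  | Main x false, _ => (q, [:: a])
  | Done _, _ => (q, [:: a])
  | _, _ => (Fail, [:: a])
  end.

Definition sfin (q : sstate) : sstate * seq sletter :=
  match q with
  | Paired x y => (Start, [:: Bar; Fr (x, y, x, ord_max, false)])
  | Tail => (Done true, [::])
  | Ready => (Main call0 false, [::])
  | Main x _ => (mnext x, [::])
  | _ => (Done false, [::])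
  end.

Definition shalt (q : sstate) := if q is Done _ then true else false.
Definition saccept (q : sstate) := if q is Done b then b else false.

Lemma sdelta_halt q a : ~~ shalt q -> ~~ shalt (sdelta q a).1.
Proof. by case: q => //; case: a => [[?|]|[?|]] //= x []. Qed.

Let ssweep := sweep sdelta sfin shalt.

Definition queue (cs : seq (seq entry)) : seq sletter := flatten [seq Bar :: map Fr c | c <- cs].

Lemma queue_cons c cs : queue (c :: cs) = Bar :: map Fr c ++ queue cs. Proof. by []. Qed.

Definition push (fr : seq entry) (cs : seq (seq entry)) := [seq p.1 :: p.2 | p <- zip fr cs].

Lemma size_push fr cs : size fr = size cs -> size (push fr cs) = size cs.
Proof. by move=> sz; rewrite size_map size2_zip ?sz. Qed.

Lemma push_cons f fr c cs : push (f :: fr) (c :: cs) = (f :: c) :: push fr cs. Proof. by []. Qed.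

Definition qsize cs : nat := size (queue cs).

Lemma size_queue_push fr cs : size fr = size cs -> qsize (push fr cs) = qsize cs + size cs.
Proof.
rewrite /qsize; elim: fr cs => [|f fr IH] [|c cs] // [sz]; rewrite push_cons !queue_cons.
by rewrite -!cat_cons !size_cat IH //= size_map; lia.
Qed.

Fixpoint msteps (x : mstate) (fr : seq entry) : mstate * seq (seq entry) :=
  if fr is f :: fr' then
    ((msteps (mstep x f).1 fr').1, (mstep x f).2 :: (msteps (mstep x f).1 fr').2)
  else (x, [::]).

Lemma mealy_skip x c w : mealy sdelta (Main x false) (map Fr c ++ w) =
  ((mealy sdelta (Main x false) w).1, map Fr c ++ (mealy sdelta (Main x false) w).2).
Proof. by elim: c => [|f c IH] //=; [case: mealy|rewrite IH]. Qed.

(** The flag is raised by a [Bar] and lowered by the next entry, so only the topmost entry of each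
    column is treated. *)
Lemma mealy_main x t fr cs : size fr = size cs -> exists t',
  mealy sdelta (Main x t) (queue (push fr cs)) =
  (Main (msteps x fr).1 t', queue [seq p.1 ++ p.2 | p <- zip (msteps x fr).2 cs]).
Proof.
elim: fr cs x t => [|f fr IH] [|c cs] x t //; first by exists t.
move=> [sz]; have [t' E'] := IH cs (mstep x f).1 false sz; exists t'.
rewrite push_cons queue_cons [msteps _ _]/= [zip _ _]/= [map _ (_ :: _)]/= queue_cons.
by case: t; rewrite /= mealy_skip E' /= map_cat -catA.
Qed.

Lemma mealy_empty x t n : exists t', mealy sdelta (Main x t) (queue (nseq n [::])) =
  (Main x t', queue (nseq n [::])).
Proof.
by elim: n t => [|n IH] t; [exists t|have [t' E'] := IH true; exists t'; case: t; rewrite /= E'].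
Qed.

Lemma sweep_main x fr cs : size fr = size cs ->
  ssweep (Main x false, queue (push fr cs)) =
  (mnext (msteps x fr).1, queue [seq p.1 ++ p.2 | p <- zip (msteps x fr).2 cs]).
Proof.
move=> sz; rewrite /ssweep /sweep /=.
by have [t' ->] := mealy_main x false sz; rewrite /= cats0.
Qed.

Lemma sweep_keep x fr cs : size fr = size cs -> (msteps x fr).2 = [seq [:: f] | f <- fr] ->
  ssweep (Main x false, queue (push fr cs)) = (mnext (msteps x fr).1, queue (push fr cs)).
Proof.
move=> sz e; rewrite sweep_main // e; congr (_, queue _).
by elim: fr cs sz {e} => [|f fr IH] [|c cs] //= [/IH ->].
Qed.

Lemma msteps_call fr z p v d : (msteps (MCall z p v d) fr).2 = [seq [:: f] | f <- fr].
Proof. by elim: fr z p v d => //= f fr IH *; rewrite IH. Qed.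

Lemma msteps_ret b fr x y z : (msteps (MRet b x y z) fr).2 = [seq [:: f] | f <- fr].
Proof. by elim: fr x y z => //= f fr IH *; rewrite IH. Qed.

Lemma msteps_retE b fr x y z : (msteps (MRet b x y z) fr).1 =
  MRet b (x || (0 < size fr)) (last y (map es fr)) (z && all (@lastS S) (map em fr)).
Proof.
elim: fr x y z => [|f fr IH] x y z /=; first by rewrite orbF andbT.
by rewrite IH orbT andbA.
Qed.

Lemma msteps_callE fr z p v d : exists p' d', (msteps (MCall z p v d) fr).1 =
  MCall (z && (sumn (map ed fr) == 0)) p'
   [&& v, (if p is Some (a, b) then path E a (map eu fr) && path E b (map ev fr)
           else sorted E (map eu fr) && sorted E (map ev fr)) &
       d + count (fun p : S * S => p.1 != p.2) (zip (map eu fr) (map ev fr)) <= 1] d'.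
Proof.
elim: fr z p v d => [|f fr IH] z p v d /=.
  by exists p, d; rewrite addn0 andbT; case: p => [[a b]|]; case: d; rewrite ?andbT.
have [p' [d' ->]] := IH (z && (ed f == 0)) (Some (eu f, ev f))
   [&& v, (if p is Some (a, b) then E a (eu f) && E b (ev f) else true) &
            ~~ (d && (eu f != ev f))] (d || (eu f != ev f)).
have dd c : (d + ((eu f != ev f) + c) <= 1) =
    ~~ (d && (eu f != ev f)) && ((d || (eu f != ev f)) + c <= 1).
  by case: (d); case: (_ != _) => //; case: c.
exists p', d'; rewrite addn_eq0 !andbA; congr (MCall _ _ _ _).
rewrite -!andbA dd; congr (_ && _); case: p => [[a b]|] /=.
  case: (E a _) => //=; case: (E b _) => /=; last by rewrite !andbF.
  by case: (~~ _); rewrite /= ?andbF -?andbA.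
by case: (~~ _); rewrite /= ?andbF -?andbA.
Qed.

Fixpoint new_frame k cm cd (fr : seq entry) := if fr is f :: fr' then
  new_entry k cm cd f :: new_frame k (mid k cm (em f)).2 (dec cd f.1.2).2 fr' else [::].
Fixpoint upd_frame k cm (fr : seq entry) := if fr is f :: fr' then
  upd_entry k cm f :: upd_frame k (mid k cm (em f)).2 fr' else [::].

Lemma sweep_push k fr cs : size fr = size cs ->
  ssweep (Main (MPush k true true) false, queue (push fr cs)) =
  (Main call0 false, queue (push (new_frame k true true fr) (push (upd_frame k true fr) cs))).
Proof.
move=> sz; rewrite sweep_main //; congr pair.
  by elim: fr true {2}true {cs sz} => //= f fr IH.
congr queue; elim: fr cs true {2 4}true sz => [|f fr IH] [|c cs] cm cd //= [sz].
by rewrite IH.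
Qed.

Lemma sweep_pop b fr cs : size fr = size cs ->
  ssweep (Main (MPop b) false, queue (push fr cs)) = (Main (ret0 b) false, queue cs).
Proof.
move=> sz; rewrite sweep_main //; congr pair.
  by elim: fr {cs sz} => //= f fr IH.
congr queue; elim: fr cs sz => [|f fr IH] [|c cs] //= [/IH ->]; by [].
Qed.
Definition midlist (k : option bool) c (m : seq S) : seq S := match k with
  | None => nseq (size m) (firstS s0) | Some true => m | Some false => incr s0 c m end.

Lemma size_new_frame k cm cd fr : size (new_frame k cm cd fr) = size fr.
Proof. by elim: fr cm cd => //= f fr IH *; rewrite IH. Qed.
Lemma size_upd_frame k cm fr : size (upd_frame k cm fr) = size fr.
Proof. by elim: fr cm => //= f fr IH *; rewrite IH. Qed.

Lemma upd_frameE k cm fr : [/\ map eu (upd_frame k cm fr) = map eu fr,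
  map ev (upd_frame k cm fr) = map ev fr, map ed (upd_frame k cm fr) = map ed fr,
  map em (upd_frame k cm fr) = midlist k cm (map em fr) &
  map es (upd_frame k cm fr) = nseq (size fr) (k == Some true)].
Proof.
split; try by elim: fr cm => //= f fr IH cm; rewrite IH.
by rewrite /midlist; case: k => [[]|]; elim: fr cm => //= f fr IH cm; rewrite IH.
Qed.

Lemma new_frameE k cm cd fr :
  map eu (new_frame k cm cd fr) = (if k == Some true then map em fr else map eu fr) /\
  map ev (new_frame k cm cd fr) = (if k == Some true then map ev fr else midlist k cm (map em fr)).
Proof.
by case: k => [[]|]; split; elim: fr cm cd => //= f fr IH cm cd; rewrite IH.
Qed.

Lemma sumn_new_frame k cm cd fr : sumn (map ed (new_frame k cm cd fr)) =
  if cd then (sumn (map ed fr)).-1 else sumn (map ed fr).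
Proof.
elim: fr cm cd => [|f fr IH] cm cd /=; first by case: cd.
have -> : ed (new_entry k cm cd f) = (dec cd f.1.2).1 by rewrite /new_entry; case: (_ == _).
rewrite IH /dec /ed; case: cd => //=.
by rewrite inordK; [case: (nat_of_ord f.1.2)|apply: leq_ltn_trans (leq_pred _) (ltn_ord _)].
Qed.

Lemma sweep_call fr cs : size fr = size cs ->
  ssweep (Main call0 false, queue (push fr cs)) =
  ((if sumn (map ed fr) == 0 then Main (MPop (hadj E (map eu fr) (map ev fr))) false
    else Main (MPush None true true) false), queue (push fr cs)).
Proof.
move=> sz; rewrite sweep_keep // ?msteps_call //.
have [p [d ->]] := msteps_callE fr true None true false.
by rewrite /= add0n /hadj andbA.
Qed.

Lemma sweep_ret b fr cs : size fr = size cs -> 0 < size fr ->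
  ssweep (Main (ret0 b) false, queue (push fr cs)) =
  (mnext (MRet b true (last false (map es fr)) (all (@lastS S) (map em fr))), queue (push fr cs)).
Proof. by move=> sz fr0; rewrite sweep_keep // ?msteps_ret // msteps_retE fr0. Qed.

Definition runs B (c c' : sstate * seq sletter) : Prop := exists2 k, iter k ssweep c = c' &
  forall i, i <= k -> size (iter i ssweep c).2 <= B.

Lemma runs_refl (B : nat) c : size c.2 <= B -> runs B c c.
Proof. by exists 0 => // -[]. Qed.

Lemma runs_trans B c1 c2 c3 : runs B c1 c2 -> runs B c2 c3 -> runs B c1 c3.
Proof.
move=> [k1 <- h1] [k2 <- h2]; exists (k2 + k1); first by rewrite iterD.
move=> i i_le; case: (leqP i k1) => [/h1 //|/ltnW k1i].
by rewrite -(subnK k1i) iterD; apply: h2; rewrite leq_subLR addnC.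
Qed.

Lemma runs_sweep B x x' cs cs' : ssweep (x, queue cs) = (x', queue cs') ->
  qsize cs <= B -> qsize cs' <= B -> runs B (x, queue cs) (x', queue cs').
Proof. by move=> e h h'; exists 1 => // -[|[]] //; rewrite /= e. Qed.

Section Evaluation.
Variables (n B : nat).
(** A frame without letters could not be told from an empty stack. *)
Hypothesis n0 : 0 < n.

(** The answer of the loop over midpoints when it has arrived at [m]. *)
Definition from_mid k U V (m : seq S) :=
  [exists m' : n.-tuple S, (value m <= value m') && (rch E n k U m' && rch E n k m' V)].

Lemma from_mid_good k U V m : size m = n -> rch E n k U m -> rch E n k m V -> from_mid k U V m.
Proof.
move=> /eqP sm h1 h2; apply/existsP; exists (Tuple sm); by rewrite leqnn h1.
Qed.

Lemma from_mid_last k U V m : size m = n -> ~~ (rch E n k U m && rch E n k m V) ->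
  all (@lastS S) m -> from_mid k U V m = false.
Proof.
move=> sm ng lm; apply/negbTE/existsPn => m'; apply: contra ng => /andP[le g].
have := value_last lm; have := value_lt m'; rewrite size_tuple sm => lt eq.
suff -> : m = m' by [].
by apply: (value_inj s0); rewrite ?size_tuple //; lia.
Qed.

Lemma from_mid_next k U V m : size m = n -> ~~ (rch E n k U m && rch E n k m V) ->
  ~~ all (@lastS S) m -> from_mid k U V m = from_mid k U V (incr s0 true m).
Proof.
move=> sm ng lm; apply: eq_existsb => m'; rewrite (value_incr s0 lm) leq_eqVlt.
case: eqP => //= e; suff <- : m = m' by rewrite (negbTE ng) andbF.
by apply: (value_inj s0); rewrite ?size_tuple.
Qed.

Lemma from_mid_first k U V m : from_mid k U V (midlist None true m) = rch E n k.+1 U V.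
Proof.
have r0 : rank (firstS s0) = 0 by apply: rank_nth; apply/card_gt0P; exists s0.
apply: eq_existsb => m'; have -> // : value (midlist None true m) = 0.
by rewrite /midlist; elim: (size m) => //= j ->; rewrite r0 muln0.
Qed.

(** Induction on the depth, and within it on the number of midpoints left. A frame takes one letter
    in each of the [n] columns, and at most [k.+1] frames lie above [cs], whence the space
    [n * k.+1]. *)
Lemma runs_eval k fr cs : size fr = n -> size cs = n -> sumn (map ed fr) = k ->
  qsize cs + n * k.+1 <= B ->
  runs B (Main call0 false, queue (push fr cs))
    (Main (ret0 (rch E n k (map eu fr) (map ev fr))) false, queue cs).
Proof.
elim: k fr cs => [|k IH] fr cs sf sc dk sB.
  have sz : size fr = size cs by rewrite sc.
  have sq := size_queue_push sz; rewrite sc in sq.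
  apply: runs_trans (runs_sweep (sweep_call sz) _ _) _; rewrite /= ?sq; try lia.
  by rewrite dk eqxx /=; apply: runs_sweep (sweep_pop _ sz) _ _; rewrite /= ?sq; lia.
set U := map eu fr; set V := map ev fr; rewrite -(from_mid_first k U V (map em fr)).
pose good m := rch E n k U m && rch E n k m V.
(* At the head of the loop the frame [mf] waits for the frame [nf], which asks for the first half;
   [r] bounds the number of midpoints left. *)
have loop r : forall nf mf, size nf = n -> size mf = n -> map eu nf = U -> map ev nf = map em mf ->
  sumn (map ed nf) = k -> map eu mf = U -> map ev mf = V -> sumn (map ed mf) = k.+1 ->
  map es mf = nseq n false -> #|S| ^ n - value (map em mf) <= r ->
  runs B (Main call0 false, queue (push nf (push mf cs)))
    (Main (ret0 (from_mid k U V (map em mf))) false, queue cs).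
  elim: r => [|r IHr] nf mf snf smf un vn dn um vm dm es_mf le_r.
    by have := value_lt (map em mf); rewrite size_map smf; lia.
  have szm : size mf = size cs by rewrite smf.
  have sq := size_queue_push szm; rewrite sc in sq.
  have sm : size (map em mf) = n by rewrite size_map.
  (* Either half may fail, so [mf'] is only required to agree with [mf] up to the flag for the half
     examined. *)
  have fail mf' : size mf' = n -> map eu mf' = U -> map ev mf' = V -> map em mf' = map em mf ->
      sumn (map ed mf') = k.+1 -> ~~ good (map em mf) ->
    runs B (Main (ret0 false) false, queue (push mf' cs))
      (Main (ret0 (from_mid k U V (map em mf))) false, queue cs).
    move=> smf' um' vm' mm' dm' ng.
    have szm' : size mf' = size cs by rewrite smf'.
    have sq' := size_queue_push szm'; rewrite sc in sq'.
    apply: runs_trans (runs_sweep (sweep_ret false szm' _) _ _) _; rewrite /= ?sq' ?smf' //; try nia.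
    rewrite mm'; case: ifPn => lm.
      rewrite (from_mid_last sm ng lm).
      by apply: runs_sweep (sweep_pop _ szm') _ _; rewrite /= ?sq'; nia.
    have [u1 v1 d1 m1 e1] := upd_frameE (Some false) true mf'.
    have [u2 v2] := new_frameE (Some false) true true mf'.
    have s1 := size_upd_frame (Some false) true mf'; have s2 := size_new_frame (Some false) true true mf'.
    have szu : size (upd_frame (Some false) true mf') = size cs by rewrite s1.
    apply: runs_trans (runs_sweep (sweep_push (Some false) szm') _ _) _; rewrite /= ?sq'; try nia.
      rewrite size_queue_push ?size_push ?s2 // size_queue_push // sc; nia.
    rewrite (from_mid_next sm ng lm) -mm' -[incr _ _ _]/(midlist (Some false) true (map em mf')) -m1.
    apply: IHr; rewrite ?s1 ?s2 ?u1 ?v1 ?u2 ?v2 ?d1 ?e1 ?sumn_new_frame ?dm' ?m1 ?smf' //=.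
    by rewrite mm' (value_incr s0 lm) subnS -subn1 leq_subLR add1n.
  apply: runs_trans (IH nf (push mf cs) _ _ _ _) _; rewrite ?size_push ?sq //; first by nia.
  rewrite un vn; case b1: (rch E n k U (map em mf)); last by apply: fail => //; rewrite /good b1.
  apply: runs_trans (runs_sweep (sweep_ret true szm _) _ _) _; rewrite /= ?sq ?smf //; try nia.
  rewrite es_mf; have -> : last false (nseq n false) = false by elim: (n).
  have [u1 v1 d1 m1 e1] := upd_frameE (Some true) true mf.
  have [u2 v2] := new_frameE (Some true) true true mf.
  have s1 := size_upd_frame (Some true) true mf; have s2 := size_new_frame (Some true) true true mf.
  have szu : size (upd_frame (Some true) true mf) = size cs by rewrite s1.
  have sq1 := size_queue_push szu; rewrite sc in sq1.
  apply: runs_trans (runs_sweep (sweep_push (Some true) szm) _ _) _; rewrite /= ?sq; try nia.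
    by rewrite size_queue_push ?size_push ?s2 // sq1 sc; nia.
  apply: runs_trans (IH _ (push (upd_frame (Some true) true mf) cs) _ _ _ _) _;
    rewrite ?size_push ?sq1 ?s2 ?sumn_new_frame ?dm //; first by nia.
  rewrite u2 v2 /= vm; case b2: (rch E n k (map em mf) V); last first.
    by apply: fail; rewrite ?s1 ?u1 ?v1 ?d1 ?m1 // /good b1 b2.
  apply: runs_trans (runs_sweep (sweep_ret true szu _) _ _) _; rewrite /= ?sq1 ?s1 ?smf //; try nia.
  rewrite e1 smf; have -> : last false (nseq n true) = true by case: (n) n0 => // j _; elim: j.
  rewrite from_mid_good //.
  by apply: runs_sweep (sweep_pop _ szu) _ _; rewrite /= ?sq1; nia.
have sz : size fr = size cs by rewrite sc.
have sq := size_queue_push sz; rewrite sc in sq.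
apply: runs_trans (runs_sweep (sweep_call sz) _ _) _; rewrite /= ?sq; try nia.
rewrite dk /=.
have [u1 v1 d1 m1 e1] := upd_frameE None true fr.
have [u2 v2] := new_frameE None true true fr.
have s1 := size_upd_frame None true fr; have s2 := size_new_frame None true true fr.
have szu : size (upd_frame None true fr) = size cs by rewrite s1.
apply: runs_trans (runs_sweep (sweep_push None sz) _ _) _; rewrite /= ?sq; try nia.
  by rewrite size_queue_push ?size_push ?s2 // size_queue_push // sc; nia.
rewrite -[from_mid _ _ _ _]/(from_mid k U V (midlist None true (map em fr))) -m1.
by apply: (loop (#|S| ^ n)); rewrite ?s1 ?s2 ?u1 ?v1 ?u2 ?v2 ?d1 ?e1 ?sumn_new_frame ?dk ?m1 ?sf //= leq_subr.
Qed.
End Evaluation.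

(** * Parsing the input into columns *)

Lemma runs_sweep1 (B : nat) c c' : ssweep c = c' -> size c.2 <= B -> size c'.2 <= B -> runs B c c'.
Proof. by move=> e h h'; exists 1 => // -[|[]] //; rewrite /= e. Qed.

Lemma mealy_copy q w : (forall a, sdelta q a = (q, [:: a])) -> mealy sdelta q w = (q, w).
Proof. by move=> e; elim: w => //= a w IH; rewrite e /= IH. Qed.

Lemma mealy_SeekSep x s w : mealy sdelta (SeekSep x) (map In (map Some s) ++ w) =
  ((mealy sdelta (SeekSep x) w).1, map In (map Some s) ++ (mealy sdelta (SeekSep x) w).2).
Proof. by elim: s => [|a s IH] //=; [case: mealy|rewrite IH]. Qed.

Definition start_entry (p : S * S) : entry := (p.1, p.2, p.1, ord_max, false).
Definition start_queue (p : seq (S * S)) := queue [seq [:: start_entry x] | x <- p].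

Lemma start_queue_rcons p a b : start_queue p ++ [:: Bar; Fr (start_entry (a, b))] = start_queue (rcons p (a, b)).
Proof. by rewrite /start_queue /queue -cats1 !map_cat flatten_cat. Qed.

Definition parsed p s y := map In (map Some s ++ None :: y) ++ start_queue p.

Lemma sweep_parse a s b y p :
  ssweep (Start, parsed p (a :: s) (Some b :: y)) = (Start, parsed (rcons p (a, b)) s y).
Proof.
rewrite /ssweep /sweep /= !map_cat -!catA mealy_SeekSep /=.
by rewrite mealy_copy //= /parsed -start_queue_rcons map_cat -!catA /= -!catA.
Qed.

Lemma sweep_parse_fail p s y : (if s is _ :: _ then ~~ (if y is Some _ :: _ then true else false) else y != [::]) ->
  exists2 w, ssweep (Start, parsed p s y) = (Done false, w) & size w <= size (parsed p s y).
Proof.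
have fl w : mealy sdelta Fail w = (Fail, w) by apply: mealy_copy.
rewrite /ssweep /sweep /parsed; case: s => [|a s] /=.
  by case: y => // x y _; rewrite /= fl; case: x => [x|] /=; eexists; try by []; rewrite /= cats0.
rewrite !map_cat -!catA mealy_SeekSep /= => h.
have -> : mealy sdelta (SeekMate a) (map In y ++ start_queue p) =
    (if (y == [::]) && (p == [::]) then SeekMate a else Fail, map In y ++ start_queue p).
  case: y h => [|[x|] y] //= _; rewrite ?fl //.
  by case: p => // x p; rewrite /start_queue /= fl.
exists (map In (map Some s) ++ In None :: map In y ++ start_queue p).
  by case: ifP => _ /=; rewrite cats0.
by rewrite !size_cat /= !size_cat !size_map; lia.
Qed.

Lemma size_parsed p s y : size (parsed p s y) = size s + (size y).+1 + 2 * size p.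
Proof.
rewrite size_cat !size_map size_cat size_map /= -/(start_queue p) /start_queue.
suff -> : size (queue [seq [:: start_entry x] | x <- p]) = 2 * size p by [].
by elim: p => // x p IH; rewrite [map _ _]/= queue_cons /= IH; lia.
Qed.

Lemma runs_parse B p s y : size (parsed p s y) <= B ->
  (exists t, [/\ y = map Some t, size t = size s &
     runs B (Start, parsed p s y) (Start, parsed (p ++ zip s t) [::] [::])]) \/
  ((forall t, size t = size s -> y <> map Some t) /\
   exists w, runs B (Start, parsed p s y) (Done false, w)).
Proof.
elim: s y p => [|a s IH] y p sB.
  case: y sB => [|x y] sB.
    by left; exists [::]; rewrite cats0; split=> //; apply: runs_refl.
  right; split; first by case.
  have [//|w e sw] := @sweep_parse_fail p [::] (x :: y); exists w.
  by apply: (runs_sweep1 e sB); apply: leq_trans sB.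
case: y sB => [|[b|] y] sB.
- right; split; first by case.
  have [//|w e sw] := @sweep_parse_fail p (a :: s) [::]; exists w.
  by apply: (runs_sweep1 e sB); apply: leq_trans sB.
- have sB' : size (parsed (rcons p (a, b)) s y) <= B.
    by move: sB; rewrite !size_parsed size_rcons /=; lia.
  have R := runs_sweep1 (sweep_parse a s b y p) sB sB'.
  case: (IH y (rcons p (a, b)) sB') => [[t [Ey st Rt]]|[nt [w Rw]]].
    left; exists (b :: t); split => /=; [by rewrite Ey|by rewrite st|].
    by rewrite -cat_rcons; apply: runs_trans R Rt.
  right; split; last by exists w; apply: runs_trans R Rw.
  by case=> [|b' t] //= [st] [_]; apply: nt.
right; split; first by case.
have [//|w e sw] := @sweep_parse_fail p (a :: s) (None :: y); exists w.
by apply: (runs_sweep1 e sB); apply: leq_trans sB.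
Qed.

Lemma sweep_ready p : ssweep (Start, parsed p [::] [::]) =
  (if p == [::] then Done true else Main call0 false, start_queue p).
Proof.
rewrite /ssweep /sweep /parsed /=; case: p => //= x p.
by rewrite mealy_copy //= cats0.
Qed.

Lemma start_queue_push p : start_queue p = queue (push (map start_entry p) (nseq (size p) [::])).
Proof. by rewrite /start_queue; congr queue; elim: p => //= x p ->. Qed.

(** The bound counts one [Bar] per column and at most [(size s * #|S|).+1] frames of [size s]
    entries each. *)
Lemma runs_decide B s t : size s = size t -> 0 < size s ->
  (size s * (size s * #|S|).+2) <= B ->
  exists w, runs B (Main call0 false, start_queue (zip s t))
                   (Done (rch E (size s) (size s * #|S|) s t), w).
Proof.
move=> st s0' sB; rewrite start_queue_push size2_zip // -?st //.
have sq j : qsize (nseq j [::]) = j by elim: j => //= j; rewrite /qsize /= => ->.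
have pu : map eu (map start_entry (zip s t)) = s by rewrite -map_comp -/unzip1 unzip1_zip // st.
have pv : map ev (map start_entry (zip s t)) = t by rewrite -map_comp -/unzip2 unzip2_zip // st.
have pd : sumn (map ed (map start_entry (zip s t))) = size s * #|S|.
  have sz : size (zip s t) = size s by rewrite size2_zip // st.
  by rewrite -sz; elim: (zip s t) => //= x p ->; rewrite mulSn.
have := @runs_eval (size s) B s0' (size s * #|S|) (map start_entry (zip s t)) (nseq (size s) [::]).
rewrite pu pv pd size_map size2_zip ?st // size_nseq -st sq => R.
have [w Rw] : exists w, runs B (Main (ret0 (rch E (size s) (size s * #|S|) s t)) false, queue (nseq (size s) [::]))
    (Done (rch E (size s) (size s * #|S|) s t), w); last first.
  by exists w; apply: runs_trans Rw; apply: R; rewrite -?mulnS.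
exists (queue (nseq (size s) [::])); apply: runs_sweep.
- rewrite /ssweep /sweep /=; have [t' ->] := mealy_empty (ret0 (rch E (size s) (size s * #|S|) s t)) false (size s).
  by rewrite /= cats0.
- by rewrite sq; apply: leq_trans sB; rewrite mulnS leq_addr.
- by rewrite sq; apply: leq_trans sB; rewrite mulnS leq_addr.
Qed.

End SavitchMachine.

Lemma map_Some_None (T : Type) (s s' : seq T) y y' :
  map Some s ++ None :: y = map Some s' ++ None :: y' -> s = s' /\ y = y'.
Proof. by elim: s s' => [|a s IH] [|a' s'] //= [] // -> /IH [-> ->]. Qed.

Lemma split_None (T : Type) (x : seq (option T)) :
  (exists s, x = map Some s) \/ (exists s y, x = map Some s ++ None :: y).
Proof.
elim: x => [|[a|] x [[s ->]|[s [y ->]]]]; first by left; exists [::].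
- by left; exists (a :: s).
- by right; exists (a :: s), y.
- by right; exists [::], (map Some s).
- by right; exists [::], (map Some s ++ None :: y).
Qed.

Theorem HWR_in_PSPACE (S : finType) (E : rel S) (s0 : S) : in_PSPACE (HWR_lang E).
Proof.
pose B (x : seq (option S)) := (#|S| + 2) * (size x).+1 ^ 2.
apply: (in_PSPACE_sweep (sdelta_halt E s0) (fin := sfin (S := S)) (inj := @In S) (q0 := @Start S)
  (acc := @saccept S) (C := #|S| + 2) (e := 2)) => // x.
suff [b [w [[K eK sK] bL]]] : exists b w, runs E s0 (B x) (@Start S, map (@In S) x) (Done S b, w) /\
    (b <-> HWR_lang E x).
  by exists K => c; have -> : c K = (Done S b, w) by exact: eK.
have xB : (size x).+1 <= B x by rewrite /B expnS expn1 mulnA leq_pmull // muln_gt0 addn_gt0 orbT.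
case: (split_None x) => [[s ex]|[s [y ex]]].
  exists false, (behead (map (@In S) x)); split; last first.
    split => // -[s' [t' [ex' _ _ _ _]]]; exfalso; move: ex'; rewrite ex.
    by elim: (s) s' => [|a s1 IH] [|a' s'] //= [_ /IH].
  have sx2 : size (map (@In S) x) <= B x by rewrite size_map ltnW.
  apply: runs_sweep1 => //; last by rewrite size_behead (leq_trans (leq_pred _)).
  rewrite ex; case: (s) => //= a s1; rewrite /sweep /=.
  by have := mealy_SeekSep E s0 a s1 [::]; rewrite cats0 => -> /=; rewrite !cats0.
have px : map (@In S) x = parsed [::] s y by rewrite ex /parsed cats0.
case: (@runs_parse S E s0 (B x) [::] s y); first by rewrite -px size_map ltnW.
  case=> t [ey st]; rewrite -px => R.
  have LE : HWR_lang E x <-> [/\ Hword E s, Hword E t & Hreach E s t].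
    rewrite ex ey; split=> [[s' [t' [/map_Some_None[-> /(inj_map Some_inj) ->]]]]|[h1 h2 h3]] //.
    by exists s, t; rewrite st.
  have sx : size x = (2 * size s).+1 by rewrite ex ey size_cat /= !size_map st; lia.
  have R2 : runs E s0 (B x) (@Start S, map (@In S) x)
     (if zip s t == [::] then Done S true else Main (call0 S) false, start_queue (zip s t)).
    apply: runs_trans R _; apply: runs_sweep1; rewrite ?sweep_ready //.
      by rewrite size_parsed size2_zip ?st //= ; lia.
    suff : size (start_queue (zip s t)) <= size (parsed (zip s t) [::] [::]).
      by rewrite size_parsed size2_zip ?st //=; lia.
    by rewrite size_cat leq_addl.
  case s0E: (size s) => [|n].
    have es : s = [::] by case: (s) s0E.
    have et : t = [::] by move: st; rewrite s0E; case: (t).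
    exists true, (start_queue (zip s t)); split; first by rewrite es et in R2 *; exact: R2.
    by rewrite LE es et; split=> // _; split=> //; apply: rt_refl.
  have n0 : 0 < size s by rewrite s0E.
  have zne : (zip s t == [::]) = false by rewrite -size_eq0 size2_zip ?st // s0E.
  rewrite zne in R2.
  have [|w R3] := @runs_decide S E s0 (B x) s t (esym st) n0; first by rewrite /B sx; move: #|S| => c; rewrite expnS expn1; nia.
  exists (rch E (size s) (size s * #|S|) s t), w; split; first exact: runs_trans R2 R3.
  rewrite LE; have le2 : #|S| ^ size s <= 2 ^ (size s * #|S|).
    rewrite mulnC expnM; case: (size s) => // j; rewrite leq_exp2r //.
    exact: ltnW (ltn_expl _ _).
  have tt : size t == size s by rewrite st.
  exact: (Hreach_rch E (in_tuple s) (Tuple tt) le2).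
case=> nt [w R]; rewrite -px in R.
exists false, w; split=> //; split=> // -[s' [t' [ex' _ _ st' _]]].
move: ex'; rewrite ex => /map_Some_None[es ey]; subst s'.
by case: (nt t').
Qed.

(** * A polynomial-time reduction scheme *)

Section Padding.
Variables (B A X L : finType) (inp : B -> A) (blank : A) (k : nat).
Variables (pl : X -> X -> L) (x0 : X) (cellw : bool -> A -> seq X) (tauw sepw headw finw : seq X).
Hypothesis cellw_gt0 : forall b a, 0 < size (cellw b a).
Hypothesis tauw_gt0 : 0 < size tauw.

Definition input_cells (w : seq B) : seq (bool * A) :=
  if map inp w is a :: r then (true, a) :: map (pair false) r else [:: (true, blank)].
(** A product that a sweep machine can build up factor by factor and that dominates
    [polyb k (size w)] by [polyb_leq_poly]. *)
Definition padding w := 2 * k * (size (input_cells w)).+1 ^ k.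
Definition padded_cells w := input_cells w ++ nseq (padding w) (false, blank).

Definition padded_pair w : seq (option L) :=
  let z := padded_cells w in
  map Some (pairmap pl x0 (flatten [seq cellw c.1 c.2 | c <- z] ++ sepw)) ++
  None :: map Some (pairmap pl x0 (headw ++ flatten (nseq (size z) tauw) ++ finw)).

Inductive rletter :=
  | RIn of B | Cell of bool & A & bool | Pad of bool | Sep | Tau | Out of option L.
Definition rletter_code l := match l with
  | RIn b => inl (inl b) | Cell f a m => inl (inr (f, a, m)) | Pad n => inr (inl n)
  | Out o => inr (inr (inl o)) | Sep => inr (inr (inr true)) | Tau => inr (inr (inr false)) end.
Definition rletter_decode l := match l with
  | inl (inl b) => RIn b | inl (inr (f, a, m)) => Cell f a m | inr (inl n) => Pad n
  | inr (inr (inl o)) => Out o | inr (inr (inr true)) => Sep | inr (inr (inr false)) => Tau end.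
Lemma rletter_codeK : cancel rletter_code rletter_decode. Proof. by case. Qed.
HB.instance Definition _ := Equality.copy rletter (can_type rletter_codeK).
HB.instance Definition _ := Choice.copy rletter (can_type rletter_codeK).
HB.instance Definition _ := Countable.copy rletter (can_type rletter_codeK).
HB.instance Definition _ := Finite.copy rletter (can_type rletter_codeK).

Inductive rstate :=
  | RRead of bool | RMul of 'I_k.+1 & bool | RConv of 'I_k.+1 | RSep | RApp of bool
  | RExp of X | RHalt.
Definition rstate_code s := match s with
  | RRead b => inl (true, b) | RApp b => inl (false, b) | RMul j b => inr (inl (j, Some b))
  | RConv j => inr (inl (j, None)) | RExp x => inr (inr (inl x))
  | RSep => inr (inr (inr true)) | RHalt => inr (inr (inr false)) end.
Definition rstate_decode s := match s with
  | inl (true, b) => RRead b | inl (false, b) => RApp b | inr (inl (j, Some b)) => RMul j b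
  | inr (inl (j, None)) => RConv j | inr (inr (inl x)) => RExp x
  | inr (inr (inr true)) => RSep | inr (inr (inr false)) => RHalt end.
Lemma rstate_codeK : cancel rstate_code rstate_decode. Proof. by case. Qed.
HB.instance Definition _ := Equality.copy rstate (can_type rstate_codeK).
HB.instance Definition _ := Choice.copy rstate (can_type rstate_codeK).
HB.instance Definition _ := Countable.copy rstate (can_type rstate_codeK).
HB.instance Definition _ := Finite.copy rstate (can_type rstate_codeK).

(* The number of pads is multiplied [k] times by the number of input cells plus
   one: each sweep of [RMul] marks one more cell and adds a new pad [Pad true]
   after each old one.  In the same way, each sweep of [RApp] marks one more cell
   and appends one [Tau]. *)
Definition stage (j : nat) : rstate := if j is j'.+1 then RMul (inord j') false else RSep.

Definition outs p (u : seq X) : seq rletter := [seq Out (Some l) | l <- pairmap pl p u].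

(** [RExp] remembers the last symbol produced, since each output letter pairs a symbol with its
    predecessor; at [Sep] the second word starts afresh from [x0]. *)
Definition rdelta (q : rstate) (x : rletter) : rstate * seq rletter :=
  match q, x with
  | RRead f, RIn b => (RRead false, [:: Cell f (inp b) false])
  | RMul j false, Cell f a false => (RMul j true, [:: Cell f a true])
  | RMul j true, Pad false => (q, [:: Pad false; Pad true])
  | RConv j, Cell f a _ => (q, [:: Cell f a false])
  | RConv j, Pad _ => (q, [:: Pad false])
  | RSep, Pad _ => (q, [:: Cell false blank false])
  | RApp false, Cell f a false => (RApp true, [:: Cell f a true])
  | RExp p, Cell f a _ => (RExp (last p (cellw f a)), outs p (cellw f a))
  | RExp p, Sep => (RExp (last x0 headw), outs p sepw ++ Out None :: outs x0 headw)
  | RExp p, Tau => (RExp (last p tauw), outs p tauw)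
  | _, _ => (q, [:: x])
  end.

Definition rfin (q : rstate) : rstate * seq rletter :=
  match q with
  | RRead f => (stage k, (if f then [:: Cell true blank false] else [::]) ++ nseq (2 * k) (Pad false))
  | RMul j found => (if found then RMul j false else RConv j, [::])
  | RConv j => (stage j, [::])
  | RSep => (RApp false, [:: Sep])
  | RApp found => if found then (RApp false, [:: Tau]) else (RExp x0, [::])
  | RExp p => (RHalt, outs p finw)
  | RHalt => (RHalt, [::])
  end.

Definition rhalt (q : rstate) := if q is RHalt then true else false.

Lemma rdelta_halt q a : ~~ rhalt q -> ~~ rhalt (rdelta q a).1.
Proof. by case: q => [?|? []|?||[]|?|]; case: a => [?|? ? []|[]| | |?]. Qed.

Let rsweep := sweep rdelta rfin rhalt.

(** No letter is ever erased, so the final word is the longest of the run and its length is the only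
    one to be estimated. *)
Lemma size_rdelta q a : 0 < size (rdelta q a).2.
Proof.
have o p u : size (outs p u) = size u by rewrite size_map size_pairmap.
case: q => [f|j [] |j| |[]|p|]; case: a => [b|f' a m|[]| | |x] //=; try (by case: m);
  rewrite ?size_cat ?o //=; lia.
Qed.

Lemma size_rsweep c : size c.2 <= size (rsweep c).2.
Proof.
rewrite /rsweep /sweep; case: ifP => // _.
have : size c.2 <= size (mealy rdelta c.1 c.2).2; last first.
  by case: (mealy _ _ _) => q w /= h; rewrite size_cat; lia.
elim: c.2 c.1 => //= a w IH q; rewrite size_cat; have := IH (rdelta q a).1; have := size_rdelta q a; lia.
Qed.

Lemma size_rsweeps i K c : i <= K -> size (iter i rsweep c).2 <= size (iter K rsweep c).2.
Proof.
move/subnK => <-; elim: (K - i) => // j IH; rewrite addSn iterS.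
exact: leq_trans IH (size_rsweep _).
Qed.

Definition C m (z : bool * A) := Cell z.1 z.2 m.

Lemma mealy_id q (T : Type) (g : T -> rletter) u : (forall t, rdelta q (g t) = (q, [:: g t])) ->
  mealy rdelta q (map g u) = (q, map g u).
Proof. by move=> e; elim: u => //= t u IH; rewrite e /= IH. Qed.

Lemma sweep_read w : rsweep (RRead true, map RIn w) =
  (stage k, map (C false) (input_cells w) ++ map Pad (nseq (2 * k) false)).
Proof.
have rest v : mealy rdelta (RRead false) (map RIn v) = (RRead false, map (C false) (map (pair false) (map inp v))).
  by elim: v => //= b v ->.
by rewrite /rsweep /sweep /input_cells map_nseq; case: w => [|b w] //=; rewrite rest.
Qed.

Definition dup (us : seq bool) := flatten [seq if b then [:: true] else [:: false; true] | b <- us].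

Lemma dupE us : count negb (dup us) = count negb us /\ size (dup us) = size us + count negb us.
Proof. by elim: us => //= b us [IH1 IH2]; rewrite /dup /= count_cat size_cat -/(dup us) IH1 IH2; case: b => /=; lia. Qed.

Lemma sweep_mul j z1 z2 us : rsweep (RMul j false, map (C true) z1 ++ map (C false) z2 ++ map Pad us) =
  if z2 is z :: z2' then
    (RMul j false, map (C true) (rcons z1 z) ++ map (C false) z2' ++ map Pad (dup us))
  else (RConv j, map (C true) z1 ++ map Pad us).
Proof.
rewrite /rsweep /sweep /= mealy_cat (@mealy_id (RMul j false) _ (C true)) //=; case: z2 => [|z z2] /=.
  by rewrite mealy_id //= cats0.
rewrite mealy_cat (@mealy_id (RMul j true) _ (C false)) //=.
have -> : mealy rdelta (RMul j true) (map Pad us) = (RMul j true, map Pad (dup us)).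
  elim: us => //= b us IH; rewrite /dup /= map_cat -/(dup us).
  by case: b; rewrite /= IH.
by rewrite /= cats0 map_rcons cat_rcons.
Qed.

Lemma mul_loop j z1 z2 us : exists us',
  [/\ iter (size z2).+1 rsweep (RMul j false, map (C true) z1 ++ map (C false) z2 ++ map Pad us) =
        (RConv j, map (C true) (z1 ++ z2) ++ map Pad us') &
      size us' = size us + size z2 * count negb us].
Proof.
elim: z2 z1 us => [|z z2 IH] z1 us.
  by exists us; rewrite cats0 addn0; split=> //; apply: (sweep_mul j z1 [::] us).
have [us' [e s]] := IH (rcons z1 z) (dup us); exists us'.
rewrite iterSr sweep_mul e cat_rcons; split=> //.
by have [c1 c2] := dupE us; rewrite s c1 c2 /= mulSn; lia.
Qed.

Lemma sweep_conv j z us : rsweep (RConv j, map (C true) z ++ map Pad us) =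
  (stage j, map (C false) z ++ map Pad (nseq (size us) false)).
Proof.
rewrite /rsweep /sweep /= mealy_cat.
have -> : mealy rdelta (RConv j) (map (C true) z) = (RConv j, map (C false) z) by elim: z => //= z1 z ->.
have -> : mealy rdelta (RConv j) (map Pad us) = (RConv j, map Pad (nseq (size us) false)) by elim: us => //= u us ->.
by rewrite /= cats0.
Qed.

(** A stage takes one sweep per cell, one that finds every cell marked, and one that removes the
    marks. Each old pad gains [size z] new ones, so the number is multiplied by [(size z).+1]. *)
Lemma iter_stage j z p : j <= k -> iter (j * (size z).+2) rsweep
    (stage j, map (C false) z ++ map Pad (nseq p false)) =
  (RSep, map (C false) z ++ map Pad (nseq (p * (size z).+1 ^ j) false)).
Proof.
elim: j p => [|j IH] p jk; first by rewrite muln1.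
have [us [e s]] := mul_loop (inord j) [::] z (nseq p false).
rewrite mulSn addnC iterD iterS [stage _]/= e sweep_conv inordK; last by lia.
rewrite IH ?(ltnW jk) // s size_nseq; congr (_, _ ++ map _ (nseq _ _)).
have -> : count negb (nseq p false) = p by rewrite count_nseq mul1n.
by rewrite expnS mulnA; congr (_ * _); rewrite mulnS mulnC.
Qed.

Lemma sweep_sep z p : rsweep (RSep, map (C false) z ++ map Pad (nseq p false)) =
  (RApp false, map (C false) (z ++ nseq p (false, blank)) ++ [:: Sep]).
Proof.
rewrite /rsweep /sweep /= mealy_cat (@mealy_id RSep _ (C false)) //=.
have -> : mealy rdelta RSep (map Pad (nseq p false)) = (RSep, map (C false) (nseq p (false, blank))).
  by elim: p => //= p ->.
by rewrite map_cat.
Qed.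

Lemma sweep_app z1 z2 t : rsweep (RApp false, map (C true) z1 ++ map (C false) z2 ++ Sep :: nseq t Tau) =
  if z2 is z :: z2' then
    (RApp false, map (C true) (rcons z1 z) ++ map (C false) z2' ++ Sep :: nseq t.+1 Tau)
  else (RExp x0, map (C true) z1 ++ Sep :: nseq t Tau).
Proof.
have tau b n : mealy rdelta (RApp b) (nseq n Tau) = (RApp b, nseq n Tau) by case: b; elim: n => //= n ->.
rewrite /rsweep /sweep /= mealy_cat (@mealy_id (RApp false) _ (C true)) //=; case: z2 => [|z z2] /=.
  by rewrite tau /= cats0.
rewrite mealy_cat (@mealy_id (RApp true) _ (C false)) //= tau /= -catA map_rcons cat_rcons /= -catA /=.
by congr (_, _ ++ _ :: _ ++ _ :: _); elim: t => //= t ->.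
Qed.

Lemma app_loop z1 z2 t : iter (size z2).+1 rsweep
    (RApp false, map (C true) z1 ++ map (C false) z2 ++ Sep :: nseq t Tau) =
  (RExp x0, map (C true) (z1 ++ z2) ++ Sep :: nseq (t + size z2) Tau).
Proof.
elim: z2 z1 t => [|z z2 IH] z1 t; first by rewrite addn0 cats0; apply: (sweep_app z1 [::] t).
by rewrite iterSr sweep_app IH cat_rcons addSnnS.
Qed.

Lemma outs_cat p u v : outs p (u ++ v) = outs p u ++ outs (last p u) v.
Proof. by rewrite /outs pairmap_cat map_cat. Qed.

Lemma sweep_exp z t : rsweep (RExp x0, map (C true) z ++ Sep :: nseq t Tau) =
  (RHalt, outs x0 (flatten [seq cellw c.1 c.2 | c <- z] ++ sepw) ++
          Out None :: outs x0 (headw ++ flatten (nseq t tauw) ++ finw)).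
Proof.
rewrite /rsweep /sweep /= mealy_cat.
have -> p : mealy rdelta (RExp p) (map (C true) z) =
    (RExp (last p (flatten [seq cellw c.1 c.2 | c <- z])), outs p (flatten [seq cellw c.1 c.2 | c <- z])).
  by elim: z p => //= c z IH p; rewrite IH outs_cat last_cat.
have tau p : mealy rdelta (RExp p) (nseq t Tau) =
    (RExp (last p (flatten (nseq t tauw))), outs p (flatten (nseq t tauw))).
  by elim: t p => //= t IH p; rewrite IH outs_cat last_cat.
by rewrite /= tau /= !outs_cat -!catA /= -?catA.
Qed.

(** In the order of [iterD], from right to left: reading, the [k] stages, separating, and one [Tau]
    per cell with a last sweep that finds no cell. The expansion is the extra sweep in
    [rsweeps_run]. *)
Definition sweeps_count w := 
  (size (padded_cells w)).+1 + (1 + (k * (size (input_cells w)).+2 + 1)).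

Lemma rsweeps_run w : iter (sweeps_count w).+1 rsweep (RRead true, map RIn w) =
  (RHalt, map Out (padded_pair w)).
Proof.
rewrite iterS /sweeps_count !iterD [iter 1 rsweep (RRead true, _)]/= sweep_read iter_stage //.
rewrite [iter 1 rsweep _]/= sweep_sep -/(padding w) -/(padded_cells w).
have := app_loop [::] (padded_cells w) 0; rewrite /= => -> /=.
by rewrite sweep_exp /padded_pair map_cat /= -!map_comp.
Qed.
Lemma size_input_cells w : 0 < size (input_cells w) <= (size w).+1.
Proof. by rewrite /input_cells; case: w => //= b w; rewrite !size_map /= leqnSn. Qed.

Lemma size_padded_cells w : size (padded_cells w) <= (2 * k * 2 ^ k).+1 * (size w).+1 ^ k.+1.
Proof.
have /andP[_ le] := size_input_cells w.
rewrite size_cat size_nseq /padding.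
have le1 : (size w).+1 <= (size w).+1 ^ k.+1 by rewrite expnS leq_pmulr // expn_gt0.
have le2 : (size (input_cells w)).+1 ^ k <= 2 ^ k * (size w).+1 ^ k.+1.
  apply: (@leq_trans ((2 * (size w).+1) ^ k)).
    by case: (k) => // j; rewrite leq_exp2r //; lia.
  by rewrite expnMn leq_mul2l leq_pexp2l ?orbT.
rewrite -[(_ * _).+1]add1n mulnDl mul1n; apply: leq_add; first exact: leq_trans le le1.
by rewrite -[2 * k * 2 ^ k * _]mulnA leq_mul2l le2 orbT.
Qed.

Theorem padded_pair_poly_time : poly_time_computable padded_pair.
Proof.
pose D := (2 * k * 2 ^ k).+1.
(* [W] bounds what one cell contributes to both words together, and [C0] is generous enough for the
   number of sweeps as well as for the length. *)
pose W := (\max_(p : bool * A) size (cellw p.1 p.2)) + size tauw.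
pose C0 := W * D + D + 2 * k + (size sepw + size headw + size finw) + k + 10.
apply: (poly_time_sweep rdelta_halt (fin := rfin) (inj := RIn) (q0 := RRead true)
  (out := fun x => if x is Out o then Some o else None) (C := C0) (e := k.+1)) => // w.
set P := _ ^ k.+1.
have P0 : 0 < P by rewrite expn_gt0.
have nP : (size w).+1 <= P by rewrite /P expnS leq_pmulr // expn_gt0.
have zP : size (padded_cells w) <= D * P := size_padded_cells w.
have /andP[_ iP] := size_input_cells w.
exists (sweeps_count w).+1 => c; have Ec : c (sweeps_count w).+1 = (RHalt, map Out (padded_pair w)).
  exact: rsweeps_run.
rewrite Ec; split=> //.
- rewrite /sweeps_count; apply: (@leq_trans ((D + 3 * k + 10) * P)).
    have h1 := leq_mul (leqnn k) (leq_trans iP nP); have h2 : 2 * k <= 2 * k * P by rewrite leq_pmulr.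
    by rewrite !mulnDl !mulnS; lia.
  by rewrite leq_mul2r; apply/orP; right; rewrite /C0; lia.
- by elim: (padded_pair w) => //= x s ->.
move=> i ile; apply: leq_trans (size_rsweeps _ ile) _; rewrite -/(c _) Ec /= size_map.
rewrite /padded_pair; move: (padded_cells w) zP => z0 zP.
rewrite size_cat /= !size_map !size_pairmap !size_cat.
have f1 (z : seq (bool * A)) : size (flatten [seq cellw x.1 x.2 | x <- z]) + size (flatten (nseq (size z) tauw)) <= size z * W.
  elim: z => //= x z IH; rewrite !size_cat mulSn.
  have : size (cellw x.1 x.2) <= \max_(p : bool * A) size (cellw p.1 p.2) by apply: (leq_bigmax x).
  rewrite /W in IH *; lia.
have := f1 z0; have := leq_mul zP (leqnn W).
rewrite /C0 => h1 h2.
apply: (@leq_trans (D * P * W + (size sepw + size headw + size finw) + 1)); first by lia.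
have h3 := leq_mul (leqnn (size sepw + size headw + size finw)) P0; rewrite muln1 in h3.
clearbody W D P; rewrite !mulnDl [D * P * W]mulnAC [D * W]mulnC; lia.
Qed.
End Padding.

(** * Completeness *)

Definition pbase : finType := base pstate slot_letter.
Definition pedge : rel (letter pbase) := sedge pdr pdl id ptl Er.

Lemma size_slots (C : Type) (prog : seq (round C)) s : 0 < size prog ->
  size (slots prog s) = size s * (size prog).+1.
Proof.
case: prog => // r prog _; elim: s => // t s IH.
by rewrite slots_cons size_cat IH /slot /= size_rcons !size_map mulSn.
Qed.

Section Instance.
Variables (B : finType) (M : TM B) (k : nat).

Definition cell_word z : seq slot_letter := slots (tm_prog M) (block (cols M) (@cbit B M) z).
Definition cellw (first : bool) (a : tm_sym M) : seq pbase :=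
  if first then [:: Lend, Hr (Run nop false) None & map Rt (cell_word (headed (tm_start M) a))]
  else map Rt (cell_word (plain a)).
Definition cell_size := size (cols M) * (size (tm_prog M)).+1.

(** Each cell yields as many erased letters in the target as it has letters in the source, which
    makes the lengths agree. The second [Rend] and the initial [Lend] of [pairmap] are the borders
    added by [encode]. *)
Definition instance : seq B -> seq (option (letter pbase)) :=
  padded_pair (tm_input M) (tm_blank M) k (@lpair pbase) Lend cellw (nseq cell_size (Lt SZ))
    [:: Rend; Rend] [:: Lend] [:: Hr Er (Some SZ); Rend; Rend].

Lemma cell_size_gt0 : 0 < cell_size.
Proof. by rewrite muln_gt0 andbT /cols !size_cat !addn_gt0 !orbT. Qed.

Lemma size_cell_word z : size (cell_word z) = cell_size.
Proof. by rewrite size_slots // size_map. Qed.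

Lemma instance_poly_time : poly_time_computable instance.
Proof.
apply: padded_pair_poly_time; last by rewrite size_nseq cell_size_gt0.
by case=> a; rewrite /= size_map size_cell_word ?cell_size_gt0.
Qed.

Let cells w := padded_cells (tm_input M) (tm_blank M) k w.
Definition init_word w := prog_word (size (cells w)) (tm_init M w).

Lemma cells_word w : flatten [seq cellw c.1 c.2 | c <- cells w] =
  [:: Lend, Hr (Run nop false) None & map Rt (init_word w)].
Proof.
have plainE (v : seq (tm_sym M)) : flatten [seq cellw c.1 c.2 | c <- map (pair false) v] =
    map Rt (slots (tm_prog M) (bits (cols M) (@cbit B M) (map (@plain B M) v))).
  elim: v => //= a v ->; rewrite -map_cat /slots; congr (map _ _).
  by rewrite [in RHS]/bits /= map_cat flatten_cat.
have nE n : nseq n (false, tm_blank M) = map (pair false) (nseq n (tm_blank M)) by rewrite map_nseq.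
have headE a v : flatten [seq cellw c.1 c.2 | c <- (true, a) :: map (pair false) v] =
   [:: Lend, Hr (Run nop false) None & map Rt (slots (tm_prog M)
      (bits (cols M) (@cbit B M) (tape [::] (headed (tm_start M) a) v)))].
  rewrite /= plainE -map_cat; do 2!congr cons; congr map.
  by rewrite /cell_word /tape /bits /slots /= map_cat flatten_cat.
rewrite /init_word /prog_word /cells /padded_cells /input_cells /tm_init.
case: (map _ w) => [|a r]; rewrite nE.
  rewrite cat_cons cat0s headE /config_bits /= size_map size_nseq.
  by congr [:: _, _ & map _ (slots _ (bits _ _ (tape _ _ (nseq _ _))))]; lia.
rewrite cat_cons -map_cat headE /config_bits /tm_space /=; congr [:: _, _ & map _ (slots _ (bits _ _ (tape _ _ (_ ++ nseq _ _))))].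
by rewrite size_map size_cat size_nseq; lia.
Qed.

Lemma size_init_word w : size (init_word w) = size (cells w) * cell_size.
Proof.
have := congr1 size (cells_word w); rewrite /= size_map.
have z0 : exists a v, cells w = (true, a) :: map (pair false) v.
  rewrite /cells /padded_cells /input_cells; case: (map _ w) => [|a r].
    by exists (tm_blank M), (nseq (padding (tm_input M) (tm_blank M) k w) (tm_blank M)); rewrite map_nseq.
  by exists a, (r ++ nseq (padding (tm_input M) (tm_blank M) k w) (tm_blank M)); rewrite map_cat map_nseq.
have [a [v ->]] := z0.
rewrite /= size_cat size_map size_cell_word => -[<-].
by rewrite mulSn; congr (_ + _); elim: v => //= b v IH; rewrite size_cat size_map size_cell_word IH mulSn.
Qed.

Definition source w := sencode (bword [::] (Hr (Run nop false) None : pbase) (init_word w)).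
Definition target w := sencode (final Er SZ (size (init_word w)).-1).

Lemma size_init_word_gt0 w : 0 < size (init_word w).
Proof.
rewrite size_init_word muln_gt0 cell_size_gt0 andbT /cells /padded_cells size_cat.
by have /andP[] := size_input_cells (tm_input M) (tm_blank M) w; lia.
Qed.

Lemma instanceE w : instance w = map Some (source w) ++ None :: map Some (target w).
Proof.
rewrite /instance /padded_pair -/(cells w) cells_word.
rewrite [X in map _ X ++ _](_ : _ = source w); last first.
  by rewrite /source /sencode /encode /bword /= -!cats1 -!catA.
rewrite [X in _ :: map _ X](_ : _ = target w) //.
rewrite /target /sencode /encode /final /bword prednK ?size_init_word_gt0 //.
rewrite rev_nseq map_nseq size_init_word; congr (pairmap _ _ _).
rewrite /= rcons_cat; congr (_ :: _ ++ _).
have nn (T : Type) (x : T) i j : nseq i x ++ nseq j x = nseq (i + j) x by elim: i => //= i ->.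
by elim: (size (cells w)) => //= n ->; rewrite nn mulSn.
Qed.
End Instance.

Theorem HWR_PSPACE_hard : PSPACE_hard (HWR_lang pedge).
Proof.
move=> B L [M [k H]]; exists (instance M k); split; first exact: instance_poly_time.
move=> w; have [[n [hn an]] sp] := H w.
set N := size (padded_cells (tm_input M) (tm_blank M) k w).
(* The padding alone already exceeds the space bound of [M]. *)
have spN i : tm_space (tm_run M i w) <= N.
  apply: leq_trans (sp i) _; apply: leq_trans (polyb_leq_poly _ _) _.
  rewrite /N /padded_cells size_cat size_nseq; apply: leq_trans (leq_addl _ _).
  rewrite leq_mul2l; apply/orP; right; case: (k) => // j; rewrite leq_exp2r // ltnS.
  by rewrite /input_cells; case: (w) => //= b v; rewrite !size_map.
have LE : HWR_lang pedge (instance M k w) <-> Hreach pedge (source M k w) (target M k w).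
  rewrite instanceE; split=> [[s [t [/map_Some_None[-> /(inj_map Some_inj) ->]]]]|h] //.
  exists (source M k w), (target M k w); split=> //.
  - by apply/sorted_encode/bword_ok.
  - by apply/sorted_encode/bword_ok.
  - have sb l x r : size (bword l x r : seq pbase) = (size l + size r).+3.
      by rewrite /bword /= size_cat /= size_rcons !size_map size_rev addnS addnS.
    rewrite /source /target /sencode !size_pairmap !size_rcons !sb size_nseq.
    by rewrite prednK ?size_init_word_gt0 // addn0.
rewrite LE; case: (boolP (accepts (tm_run M n w))) => [acc|nacc].
  split=> _; last by apply/an; case/andP: acc.
  have [m E] := pshuttle_accept spN acc.
  apply: (shuttle_accept pdr_Er (fun _ => erefl) (n := m)).
  by rewrite prednK ?size_init_word_gt0 //; apply: E.
have nL : ~ L w by move=> /an a; case/andP: nacc.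
split=> // h; exfalso; apply: (shuttle_reject pdr_Er _ h); apply: pshuttle_reject spN _ => m.
apply: contra nacc => /andP[hm am].
(* Both [n] and [m] are halting times, and a run has only one halting configuration; so acceptance
   at any time shows at time [n]. *)
suff -> : tm_run M n w = tm_run M m w by rewrite /accepts hm.
case: (leqP m n) => [mn|/ltnW nm].
  by rewrite /tm_run -(subnK mn) iterD tm_halted_run.
by rewrite /tm_run -(subnK nm) iterD [in RHS]tm_halted_run.
Qed.

Theorem theorem2 :
  exists (S : finType) (E : rel S), PSPACE_complete (HWR_lang E).
Proof.
exists (letter pbase), pedge; split; last exact: HWR_PSPACE_hard.
exact: (HWR_in_PSPACE pedge (inl (Lend, Lend))).
Qed.
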